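(* Almost all posets $P$ on $N$ elements satisfy \[c_\star(P)=\frac{\log 2}{3}+O\!\left(\frac{1}{\log N}\right),\] where the lower-order term is positive. That is, there is a constant $K>0$ such that, as $N\to\infty$, the proportion of partial orders $P$ on a fixed labelled $N$-element set with $0<c_\star(P)-\frac{\log 2}{3}\le \frac{K}{\log N}$ tends to $1$.
   Context: Definition of $c_\star(P)$ for a finite poset $P$: Let $\mathcal{A}(P)$ be the set of antichains of $P$ (including the empty antichain). For nonempty $Q\subseteq P$ (induced order) and $S\in\mathcal{A}(P)$, the shadow $\partial_QS$ is the set of $y\in Q$ such that some $x\in S$ has $x\le_P y$, and no $z\in Q$ with $z<_Py$ satisfies $x\le_P z$ for some $x\in S$. A weighting of $P$ is $\alpha:\mathcal{A}(P)\to[0,\infty)$ with total sum $1$; its shadow on $Q$ is $(\partial_Q\alpha)(T)=\sum_{S:\,\partial_QS=T}\alpha(S)$ for antichains $T$ of $Q$. With entropy $H(\beta)=-\sum_T\beta(T)\log\beta(T)$ (natural log, $0\log0=0$), $c_\star(P)=\max_\alpha\min_{\emptyset\neq Q\subseteq P}H(\partial_Q\alpha)/|Q|$. *)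

(* Defs.v *)
From HB Require Import structures.
From mathcomp Require Import all_boot all_order all_algebra.
From mathcomp Require Import all_classical all_reals all_analysis.

Set Implicit Arguments.
Unset Strict Implicit.
Unset Printing Implicit Defensive.

Import Order.TTheory GRing.Theory Num.Theory.
Import numFieldNormedType.Exports.

Local Open Scope ring_scope.

(* A binary relation on a finite type T is coded by its graph, so that the
   relations on T form a finite type and can be counted. *)
Definition rel_of (T : finType) (P : {set T * T}) : rel T :=
  fun x y => (x, y) \in P.

(* The (non-strict) partial orders on the labelled set T. *)
Definition posets (T : finType) : {set {set T * T}} :=
  [set P | `[< [/\ reflexive (rel_of P), antisymmetric (rel_of P)
                 & transitive (rel_of P)] >]].

Section Poset.
Variables (T : finType) (le : rel T).

Definition antichain (S : {set T}) : bool :=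
  [forall x in S, forall y in S, le x y ==> (x == y)].

Definition above (S : {set T}) (y : T) : bool := [exists x in S, le x y].

Definition shadow (Q S : {set T}) : {set T} :=
  [set y in Q | above S y &&
     ~~ [exists z in Q, [&& le z y, z != y & above S z]]].

Section Weighting.
Variable R : realType.

(* Weightings, and the functions on antichains derived from them, are given
   as functions on all subsets; only their values on antichains matter. *)
Definition weighting (a : {set T} -> R) : Prop :=
  (forall S, antichain S -> 0 <= a S) /\ \sum_(S | antichain S) a S = 1.

Definition wshadow (Q : {set T}) (a : {set T} -> R) (A : {set T}) : R :=
  \sum_(S | antichain S && (shadow Q S == A)) a S.

(* Entropy of a function on the antichains of the induced suborder Q; these
   are the antichains of the whole order contained in Q. Note ln 0 = 0. *)
Definition entropy (Q : {set T}) (b : {set T} -> R) : R :=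
  - \sum_(A : {set T} | antichain A && (A \subset Q)) b A * ln (b A).

Definition rate (a : {set T} -> R) (Q : {set T}) : R :=
  entropy Q (wshadow Q a) / #|Q|%:R.

(* For nonempty T the default value of the iterated minimum, rate a setT, is
   itself one of the values over which the minimum is taken. *)
Definition min_rate (a : {set T} -> R) : R :=
  \big[Num.min/rate a [set: T]]_(Q : {set T} | Q != finset.set0) rate a Q.

(* The supremum is a maximum: see cstar_max below. *)
Definition cstar : R := sup [set min_rate a | a in [set a | weighting a]].

End Weighting.
End Poset.

Section CstarMax.
Local Open Scope classical_set_scope.

Lemma continuous_mul_ln (R : realType) : continuous (fun x : R => x * ln x).
Proof.
move=> x; have [x0|x0|->] := ltgtP x 0.
- rewrite /continuous_at [in nbhs (x * _)]ln0 ?ltW// mulr0.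
  apply: (@cvg_trans _ (nbhs (fmap (fun=> 0 : R) (nbhs x)))); last exact: cvg_cst.
  apply: near_eq_cvg; near=> y; rewrite ln0 ?mulr0// ltW//.
  by near: y; exact: lt_nbhsl.
- by apply: cvgM; [exact: cvg_id|exact: continuous_ln].
have bnd (y : R) : `|y| < 1 -> `|y * ln y| <= Num.sqrt `|y| *+ 2.
  move=> y1; have [y0|y0] := leP y 0.
    by rewrite ln0// mulr0 normr0 mulrn_wge0// sqrtr_ge0.
  rewrite (gtr0_norm y0) in y1 *.
  set s := Num.sqrt y; have s0 : 0 < s by rewrite sqrtr_gt0.
  have ys : y = s ^+ 2 by rewrite sqr_sqrtr// ltW.
  have s1 : s <= 1 by rewrite -sqrtr1 ler_sqrt// ltW.
  have := @ln_sublinear R s^-1; rewrite invr_gt0 lnV ?posrE// => /(_ s0) h.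
  rewrite ys lnXn// mulrnAr normrMn lerMn2r/= normrM (ler0_norm (ln_le0 s1)).
  rewrite ger0_norm ?sqr_ge0//.
  rewrite (le_trans (ler_wpM2l (sqr_ge0 _) (ltW h)))//.
  by rewrite expr2 -mulrA divff ?mulr1// gt_eqF.
have lim0 : Num.sqrt `|y| *+ 2 @[y --> (0 : R)] --> (0 : R).
  rewrite -[X in _ --> X](_ : Num.sqrt `|0 : R| *+ 2 = 0); last first.
    by rewrite normr0 sqrtr0 mul0rn.
  apply: (@continuous_comp _ _ _ (fun y : R => Num.sqrt `|y|) (fun z => z *+ 2)).
    apply: (@continuous_comp _ _ _ (fun y : R => `|y|) Num.sqrt).
      exact: norm_continuous.
    exact: sqrt_continuous.
  exact: natmul_continuous.
rewrite /continuous_at mul0r.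
have limN : - (Num.sqrt `|y| *+ 2) @[y --> (0 : R)] --> (0 : R).
  have h := cvgN lim0; rewrite oppr0 in h; exact: h.
apply: (squeeze_cvgr _ limN lim0).
have : \forall y \near (0 : R), `|y| < 1.
  by apply/nbhs_ballP; exists 1 => [|z] /=; [exact: ltr01|rewrite /ball/= sub0r normrN].
by apply: filterS => y y1; rewrite -ler_norml bnd.
Unshelve. all: by end_near. Qed.

Lemma cstar_max (T : finType) (le : rel T) (R : realType) :
  exists a : {set T} -> R,
    [/\ weighting le a, cstar le R = min_rate le a
      & forall b : {set T} -> R, weighting le b -> min_rate le b <= min_rate le a].
Proof.
pose K := prod_topology (fun _ : {set T} => R : topologicalType).
have pc (S : {set T}) : continuous (fun a : K => a S : R).
  exact: (@proj_continuous _ (fun _ : {set T} => R : topologicalType) S).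
have sumc (X : topologicalType) (I : finType) (P : pred I) (F : I -> X -> R) :
    (forall i, continuous (F i)) -> continuous (fun x => \sum_(i | P i) F i x).
  by move=> Fc; apply: continuous_big => // -[u v]; exact: add_continuous.
have sc (P : pred {set T}) : continuous (fun a : K => \sum_(S | P S) a S : R).
  exact: (sumc K _ P (fun S (a : K) => a S) pc).
have wc Q A : continuous (fun a : K => wshadow le Q a A : R) by exact: sc.
have tc Q A : continuous (fun a : K => wshadow le Q a A * ln (wshadow le Q a A) : R).
  move=> a; exact: (@continuous_comp _ _ _ (fun a : K => wshadow le Q a A)
    (fun x : R => x * ln x) a (wc Q A a) (@continuous_mul_ln R _)).
have ec Q : continuous (fun a : K => entropy le Q (wshadow le Q a) : R).
  move=> a.
  exact: (cvgN (sumc K _ (fun A : {set T} => antichain le A && (A \subset Q))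
    (fun A (a : K) => wshadow le Q a A * ln (wshadow le Q a A)) (tc Q) a)).
have rc Q : continuous (fun a : K => rate le a Q : R).
  move=> a; exact: (cvgM (ec Q a) (cvg_cst (#|Q|%:R^-1 : R))).
have minc (r : seq {set T}) : continuous (fun a : K =>
    \big[Num.min/rate le a [set: T]]_(Q <- r | Q != finset.set0) rate le a Q : R).
  elim: r => [|Q r IH].
    have -> : (fun a : K => \big[Num.min/rate le a [set: T]]_(Q <- [::]
        | Q != finset.set0) rate le a Q : R) = fun a => rate le a [set: T].
      by apply/funext => a; rewrite big_nil.
    exact: rc.
  have [Q0|Q0] := boolP (Q != finset.set0); last first.
    under [X in continuous X]eq_fun do rewrite big_cons (negbTE Q0).
    exact: IH.
  under [X in continuous X]eq_fun do rewrite big_cons Q0.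
  by move=> a; exact: (@continuous_min R K _ _ a (rc Q a) (IH a)).
have mc : continuous (fun a : K => min_rate le a : R) by exact: minc.
pose C := [set a : K | forall S, (`[0, 1] : set R) (a S)] `&`
  [set a : K | \sum_(S | antichain le S) a S = 1 :> R].
have Cw (a : {set T} -> R) : C a -> weighting le a.
  by case=> a01 a1; split => // S _; have := a01 S; rewrite /= in_itv => /andP[].
have cC : compact C.
  apply: compact_closedI.
    apply: (@tychonoff _ (fun _ : {set T} => R : topologicalType)
      (fun _ => `[0, 1])) => _; exact: segment_compact.
  apply: (@preimage_closed K R (fun a => \sum_(S | antichain le S) a S) [set 1]).
    by move=> a _; exact: sc.
  exact: (@closed_eq R).
have C0 : C !=set0.
  have ac0 : antichain le finset.set0.
    by apply/forall_inP => x; rewrite inE.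
  exists (fun S => (S == finset.set0)%:R); split.
    by move=> S /=; rewrite in_itv/= ler0n lern1 leq_b1.
  rewrite /= (bigD1 finset.set0)//= eqxx big1 ?addr0// => S /andP[_ /negbTE->].
  by [].
have [a] := compact_EVT_max C0 cC (continuous_subspaceT mc).
rewrite inE => Ca amax.
have {}amax b : weighting le b -> min_rate le b <= min_rate le a.
  move=> [b0 b1]; pose b' S : R := if antichain le S then b S else 0.
  have Cb' : C b'.
    split=> [S|] /=; last by rewrite -[RHS]b1; apply: eq_bigr => S; rewrite /b' => ->.
    rewrite in_itv/= /b'; case: ifPn => aS; last by rewrite lexx ler01.
    rewrite b0//= -b1 (bigD1 S)//= lerDl sumr_ge0// => A /andP[aA _].
    exact: b0.
  suff -> : min_rate le b = min_rate le b' by apply: amax; rewrite inE.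
  have rE Q : rate le b Q = rate le b' Q.
    rewrite /rate /entropy; congr (- _ / _); apply: eq_bigr => A _.
    suff -> : wshadow le Q b A = wshadow le Q b' A by [].
    by apply: eq_bigr => S /andP[aS _]; rewrite /b' aS.
  by rewrite /min_rate rE; apply: eq_bigr.
exists a; split => //; first exact: Cw.
have ub : ubound [set min_rate le b | b in [set b | weighting le b]] (min_rate le a).
  by move=> _ [b wb <-]; exact: amax.
apply/eqP; rewrite eq_le; apply/andP; split.
  apply: ge_sup => //; exists (min_rate le a), a => //; exact: Cw.
apply: ub_le_sup; first by exists (min_rate le a).
exists a => //; exact: Cw.
Qed.

End CstarMax.

(* Main.v *)
(* The upper bound on cstar comes from sets Q = A' + B' + C' of size 3m, with m of
   order N, that carry only 2 ^ (m + o(m / log N)) antichains; the lower bound holds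
   for every poset with three levels: put weight 1/3 on a uniformly random subset of
   each level. By concavity of entropy the rate is at least log 2 / 3, with equality
   only if the three shadows have the same distribution. Then Q misses the bottom
   level, and the common entropy, being at least log 2 times the size of the part of Q
   in each level, still exceeds the average.

   That almost all posets are of this kind is the Kleitman-Rothschild theorem. Hasse
   diagrams are triangle-free and satisfy a condition on 4-cycles; this class of
   digraphs is closed under deleting a vertex. Let u(n) = 2 ^ (n^2 / 4 + 3n / 2). If the
   neighbourhood of a vertex v is squeezed into a set of at most (1/2 - g) n vertices
   that can be described by boundedly many vertices, there are few ways of adding v to
   the rest, so by induction such digraphs number at most u(n) 2 ^ (- c n). In the others,
   every vertex has a bounded set of neighbours that dominates half of the graph, which
   forces a bipartition. The 4-cycle condition then leaves two cases: either one
   side consists of middle vertices and the graph has three layers, or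
   nearly all edges point from one side to the other, which
   accounts for about 2 ^ (n^2 / 4 + n) digraphs only. *)

Require Import Defs.
From mathcomp Require Import all_boot all_order all_algebra.
From mathcomp Require Import all_classical all_reals all_analysis.
From mathcomp Require Import ring lra zify.

Set Implicit Arguments.
Unset Strict Implicit.
Unset Printing Implicit Defensive.

Import Order.TTheory GRing.Theory Num.Theory.
Import numFieldNormedType.Exports.
Import fintype boot.finset.

Local Open Scope ring_scope.

(** * Density of vertex sets and Hasse-like digraphs *)

(** A new vertex [v] costs about [2 ^ (n / 2)] for its neighbourhood and, a priori, another
    exponential factor for the directions of its edges. The 4-cycle condition removes the second
    factor: every 4-cycle has an even number of forward edges, so the directions between [v] and a
    bounded set [s] force all others once each neighbour of [v] lies on a 4-cycle through [v] and
    [s]. A layered digraph owes its exponent [3 n / 2] to [n] bits for the middle layer and [n / 2]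
    bits for splitting the complement; every other class must lose a linear amount against this.
    Each irreducibility condition has a gap [g] and a slack [eps]. The slack is chosen after the
    gap, so that sets of density at most [eps] number at most [2 ^ (g n / 2)] and half of the gap
    survives. The threshold [r] for density between layers is of order [sqrt n]: then [r ^ 2] beats
    the [4 n] bits naming two layers and two subsets, while an antichain has at most [2 r] vertices
    of [Q] outside one layer. These cost [O(sqrt n log n)] in the exponent, far less than
    [n / log n]. *)

Section Density.
Variables (R : realFieldType) (T : finType).
Implicit Types A B C : {set T}.

Definition density A : R := #|A|%:R / #|T|%:R.

Lemma density_ge0 A : 0 <= density A.
Proof. by rewrite divr_ge0. Qed.

Lemma densityS A B : A \subset B -> density A <= density B.
Proof. by move=> AB; rewrite ler_wpM2r ?invr_ge0// ler_nat subset_leq_card. Qed.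

Lemma densityT : (0 < #|T|)%N -> density [set: T] = 1.
Proof. by move=> T0; rewrite /density cardsT divff// pnatr_eq0 -lt0n. Qed.

Lemma densityUI A B :
  density (A :|: B) + density (A :&: B) = density A + density B.
Proof. by rewrite -!mulrDl -!natrD cardsUI. Qed.

Lemma densityID A B : density A = density (A :&: B) + density (A :\: B).
Proof. by rewrite -mulrDl -natrD cardsID. Qed.

Lemma densityC A : (0 < #|T|)%N -> density (~: A) = 1 - density A.
Proof.
by move=> T0; rewrite -(densityT T0) (densityID setT A) setTI setTD; ring.
Qed.

Lemma density_gt0 A : 0 < density A -> exists x, x \in A.
Proof.
have [->|[x xA] _] := set_0Vmem A; last by exists x.
by rewrite /density cards0 mul0r ltxx.
Qed.

(* [A \ C] is covered by [A \ B] and [B \ C]. *)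
Lemma density_trans A B C :
  density (A :\: C) <= density (A :\: B) + density (B :\: C).
Proof.
have := densityUI (A :\: B) (B :\: C).
have := density_ge0 ((A :\: B) :&: (B :\: C)).
have : A :\: C \subset (A :\: B) :|: (B :\: C).
  by apply/subsetP => x; rewrite !inE; do 3!case: (_ \in _).
move/densityS; lra.
Qed.

End Density.

(** * Digraphs with the local path conditions of Hasse diagrams *)

Section Graph.
Variables (T : finType) (e : rel T).
Implicit Types (v w x y z : T) (Q s Z A : {set T}).

(* Hasse diagrams have this property, and it is inherited by induced subgraphs. *)
Definition hasse_like :=
  (forall x y z, e x y -> e y z -> ~~ (e x z || e z x)) /\
  (forall x y z w, e x y -> e y z -> e z w -> ~~ (e x w || e w x)).

Definition adj x y := e x y || e y x.
Definition outs v := [set w | e v w].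
Definition ins v := [set w | e w v].
Definition nbr v := [set w | adj v w].
Definition nbrs Q := [set w | [exists q in Q, adj q w]].

(* [Z] is a union of classes of vertices attached to [s] in the same way. *)
Definition definable s Z := forall w w',
  {in s, forall q, e q w = e q w' /\ e w q = e w' q} -> (w \in Z) = (w' \in Z).

(* When the edges at [v] are known up to direction, the directions of those towards
   [s] then force all the others, by [hasse_square]. *)
Definition orients s v := forall w, adj v w ->
  exists q z, [/\ q \in s, adj v q, z != v, adj q z & adj w z].

Lemma adjC x y : adj x y = adj y x.
Proof. exact: orbC. Qed.

Lemma adjE x y : adj x y = e x y || e y x.
Proof. by []. Qed.

Lemma nbrP v w : reflect (e v w \/ e w v) (adj v w).
Proof. exact: orP. Qed.

Lemma nbrU v : nbr v = outs v :|: ins v.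
Proof. by apply/setP => w; rewrite !inE. Qed.

Lemma nbrs1 v : nbrs [set v] = nbr v.
Proof.
apply/setP => w; rewrite !inE; apply/exists_inP/idP => [[q]|vw].
  by rewrite inE => /eqP->.
by exists v; rewrite ?inE.
Qed.

Lemma nbrsU Q Q' : nbrs (Q :|: Q') = nbrs Q :|: nbrs Q'.
Proof.
apply/setP => w; rewrite !inE; apply/exists_inP/orP => [[q]|].
  by rewrite inE => /orP[qQ|qQ] qw; [left|right]; apply/exists_inP; exists q.
by case=> /exists_inP[q qQ qw]; exists q; rewrite // inE qQ ?orbT.
Qed.

Lemma nbrsS Q Q' : Q \subset Q' -> nbrs Q \subset nbrs Q'.
Proof. by move=> /setUidPr <-; rewrite nbrsU subsetUl. Qed.

Lemma nbr_sub_nbrs v Q : v \in Q -> nbr v \subset nbrs Q.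
Proof. by move=> vQ; rewrite -nbrs1 nbrsS// sub1set. Qed.

Lemma definableS s s' Z : s \subset s' -> definable s Z -> definable s' Z.
Proof. by move=> /subsetP ss' d w w' h; apply: d => q /ss'; exact: h. Qed.

Lemma definableU s Z Z' : definable s Z -> definable s Z' -> definable s (Z :|: Z').
Proof. by move=> d d' w w' h; rewrite !inE (d _ _ h) (d' _ _ h). Qed.

Lemma definableI s Z Z' : definable s Z -> definable s Z' -> definable s (Z :&: Z').
Proof. by move=> d d' w w' h; rewrite !inE (d _ _ h) (d' _ _ h). Qed.

Lemma definableC s Z : definable s Z -> definable s (~: Z).
Proof. by move=> d w w' h; rewrite !inE (d _ _ h). Qed.

Lemma definableD s Z Z' : definable s Z -> definable s Z' -> definable s (Z :\: Z').
Proof. by move=> d d' w w' h; rewrite !inE (d _ _ h) (d' _ _ h). Qed.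

Lemma definable_outs s v : v \in s -> definable s (outs v).
Proof. by move=> vs w w' h; rewrite !inE; case: (h _ vs). Qed.

Lemma definable_ins s v : v \in s -> definable s (ins v).
Proof. by move=> vs w w' h; rewrite !inE; case: (h _ vs). Qed.

Lemma definable_nbr s v : v \in s -> definable s (nbr v).
Proof.
by move=> vs; rewrite nbrU; apply: definableU; [exact: definable_outs|exact: definable_ins].
Qed.

Lemma definable_nbrs s Q : Q \subset s -> definable s (nbrs Q).
Proof.
move=> /subsetP Qs w w' h; rewrite !inE; apply: eq_existsb => q.
by case: (boolP (q \in Q)) => //= /Qs/h[]; rewrite /adj => -> ->.
Qed.

Lemma orientsS s s' v : s \subset s' -> orients s v -> orients s' v.
Proof.
by move=> /subsetP ss' o w /o[q [z [/ss' qs a1 a2 a3 a4]]]; exists q, z.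
Qed.

Section Local.
Hypothesis he : hasse_like.

Lemma hasse_path2 x y z : e x y -> e y z -> ~~ adj x z.
Proof. by case: he => h _; exact: h. Qed.

Lemma hasse_path3 x y z w : e x y -> e y z -> e z w -> ~~ adj x w.
Proof. by case: he => _; exact. Qed.

Lemma hasse_irr x : e x x = false.
Proof. by apply/negP => xx; have := hasse_path2 xx xx; rewrite /adj xx. Qed.

Lemma hasse_asym x y : e x y -> ~~ e y x.
Proof.
by move=> xy; apply/negP => yx; have := hasse_path3 xy yx xy; rewrite /adj xy.
Qed.

Lemma adjxx x : adj x x = false.
Proof. by rewrite /adj hasse_irr. Qed.

Lemma adj_rev x y : adj x y -> e y x = ~~ e x y.
Proof.
by case/nbrP => [xy|yx]; [rewrite xy (negbTE (hasse_asym xy))|rewrite yx (negbTE (hasse_asym yx))].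
Qed.

Lemma triangle_free x y z : adj x y -> adj y z -> ~~ adj x z.
Proof.
move=> xy yz; apply/negP => /nbrP xz; move: xy yz xz.
case/nbrP => xy; case/nbrP => yz; case => xz.
- by have := hasse_path2 xy yz; rewrite /adj xz.
- by have := hasse_path2 xy yz; rewrite /adj xz orbT.
- by have := hasse_path2 xz yz; rewrite /adj xy.
- by have := hasse_path2 xz xy; rewrite /adj yz.
- by have := hasse_path2 xy xz; rewrite /adj yz.
- by have := hasse_path2 yz xz; rewrite /adj xy.
- by have := hasse_path2 yz xy; rewrite /adj xz orbT.
- by have := hasse_path2 yz xy; rewrite /adj xz.
Qed.

Lemma nbr_disjoint_nbrs v Q : Q \subset nbr v -> nbr v :&: nbrs Q = set0.
Proof.
move=> /subsetP Qv; apply/setP => w; rewrite !inE; apply/andP => -[vw /exists_inP[q qQ qw]].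
have := Qv _ qQ; rewrite inE => vq.
by have := triangle_free vq qw; rewrite vw.
Qed.

(* Going round the 4-cycle [v q z w], an odd number of forward edges would give
   a directed path of length 3 whose end points are adjacent. *)
Lemma hasse_square v q z w : adj v q -> adj q z -> adj w z -> adj v w ->
  e v w = (e v q == (e q z == e w z)).
Proof.
move=> vq qz wz vw; have P a b c d : adj a d -> ~~ [&& e a b, e b c & e c d].
  by move=> ad; apply/and3P => -[ab bc cd]; have := hasse_path3 ab bc cd; rewrite ad.
move: (P v q z w vw) (P q z w v) (P z w v q) (P w v q z) (P w z q v) (P z q v w)
  (P q v w z) (P v w z q vq).
rewrite (adjC q v) (adjC w v) (adjC z q) (adjC z w) vq qz wz vw => h1 h2 h3 h4 h5 h6 h7 h8.
move: h1 (h2 isT) (h3 isT) (h4 isT) (h5 isT) (h6 isT) (h7 isT) h8.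
rewrite (adj_rev vq) (adj_rev qz) (adj_rev wz) (adj_rev vw).
by do 4!case: (e _ _).
Qed.

End Local.
End Graph.

(** * Irreducible digraphs *)

(* Failure of [irreducible] means that the neighbourhood of some [v] is, given the
   rest of the graph, one of few sets. *)
Definition irreducible (R : realFieldType) (T : finType) (e : rel T) (k : nat) (g eps : R) :=
  forall v (s Z : {set T}), (#|s| <= k)%N -> v \notin s -> orients e s v ->
  definable e s Z -> density R (nbr e v :\: Z) <= eps -> 1 / 2 - g < density R Z.

(** * Second neighbourhoods in irreducible digraphs *)

Section Structure.
Variables (R : realFieldType) (T : finType) (e : rel T).
Hypothesis he : hasse_like e.
Local Notation mu := (density R).
Local Notation nbr := (nbr e).
Local Notation nbrs := (nbrs e).
Local Notation adj := (adj e).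
Implicit Types (v w x y z u : T) (Q s Z A : {set T}).

Lemma nbr_notin v Q : Q \subset nbr v -> v \notin Q.
Proof. by move/subsetP => h; apply/negP => /h; rewrite inE (adjxx he). Qed.

(** A largest [Q] whose members contribute [er] each on average works: a vertex of [S] with more
    than [er] new neighbours could still be added. Since [nbrs Q] has density at most 1, so has
    [er * #|Q|]. *)
Lemma greedy_cover (er : R) (q : nat) (S : {set T}) : (0 < #|T|)%N ->
  0 < er -> er^-1 <= q%:R ->
  exists Q, [/\ Q \subset S, (#|Q| <= q)%N &
    forall u, u \in S -> mu (nbr u :\: nbrs Q) <= er].
Proof.
move=> T0 er0 erq.
pose P Q := (Q \subset S) && (er * #|Q|%:R <= mu (nbrs Q)).
have P0 : P set0 by rewrite /P sub0set cards0 mulr0 density_ge0.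
case: (@arg_maxnP _ set0 P (fun Q => #|Q|) P0) => Q /andP[QS Qer] Qmax.
exists Q; split => //.
  rewrite -(ler_nat R) (le_trans _ erq)// -[leRHS]mul1r ler_pdivlMr// mulrC.
  by rewrite (le_trans Qer)// -(densityT R T0) densityS// subsetT.
move=> u uS; rewrite leNgt; apply/negP => uer.
have uQ : u \notin Q.
  apply: contraTN uer => uQ; rewrite -leNgt (_ : _ :\: _ = set0) ?/density ?cards0 ?mul0r ?ltW//.
  by apply/eqP; rewrite setD_eq0 nbr_sub_nbrs.
have : P (u |: Q).
  rewrite /P subUset sub1set uS QS/= cardsU1 uQ natrD nbrsU nbrs1.
  rewrite (densityID _ _ (nbrs Q)) setUC setUK setDUl setDv set0U.
  by rewrite mulrDr mulr1 addrC lerD// ltW.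
by move=> /Qmax/=; rewrite cardsU1 uQ ltnn.
Qed.

Lemma density_set1 x : mu [set x] = 1 / #|T|%:R.
Proof. by rewrite /density cards1. Qed.

Lemma density_card A (q : nat) : (#|A| <= q)%N -> mu A <= q%:R / #|T|%:R.
Proof. by move=> Aq; rewrite ler_wpM2r ?invr_ge0// ler_nat. Qed.

Section Irreducible.
Variables (q k : nat) (d0 d er ge : R).
Hypothesis T0 : (0 < #|T|)%N.
Hypothesis qk : (3 * q + 2 <= k)%N.
Hypothesis mindeg : forall v, d0 < mu (nbr v).
Hypothesis er0 : 0 < er.
Hypothesis erq : er^-1 <= q%:R.
Hypothesis big : q.+2%:R / #|T|%:R + er < d0.
Hypothesis irr_d : irreducible e k d er.
Hypothesis irr_ge : irreducible e k ge (2 * d).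

Lemma q_gt0 : (0 < q)%N.
Proof. by rewrite -(ltr_nat R) (lt_le_trans _ erq)// invr_gt0. Qed.

Lemma d0_gt : er < d0 /\ 1 / #|T|%:R + er < d0 /\ q%:R / #|T|%:R + 1 / #|T|%:R < d0.
Proof.
have n0 : 0 <= #|T|%:R^-1 :> R by rewrite invr_ge0.
have q0 : 0 <= q%:R :> R by [].
have : q.+2%:R / #|T|%:R = q%:R / #|T|%:R + 2 * (1 / #|T|%:R) :> R by rewrite -addn2 natrD; ring.
have : 0 <= q%:R / #|T|%:R :> R by rewrite mulr_ge0.
have : 0 <= 1 / #|T|%:R :> R by rewrite mul1r.
move: big er0; move: (_ / _) (_ / _) (_ / _) => a b c; lra.
Qed.

(** Cover [nbr v] greedily by [D]. A neighbour [w] of [v] has degree above [d0] but at most [er]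
    outside [nbrs D], so it shares a neighbour other than [v] with some vertex of [D]. *)
Lemma orients_exists v : exists D : {set T}, [/\ D \subset nbr v, (#|D| <= q)%N & orients e D v].
Proof.
have [D [Dv Dq Der]] := greedy_cover (nbr v) T0 er0 erq.
exists D; split => // w vw.
have wv : w \in nbr v by rewrite inE.
have : 0 < mu ((nbr w :&: nbrs D) :\ v).
  have := Der _ wv; have := mindeg w; have [_ [b _]] := d0_gt.
  have := densityID R (nbr w) (nbrs D).
  have := densityID R (nbr w :&: nbrs D) [set v].
  have := densityS R (subsetIr (nbr w :&: nbrs D) [set v]).
  rewrite density_set1; move: b; move: (1 / _) => ?; lra.
case/density_gt0 => z; rewrite !inE => /andP[zv /andP[wz /exists_inP[p pO pz]]].
exists p, z; split => //; first by have := subsetP Dv _ pO; rewrite inE.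
Qed.

(** This removes the orientation clause from irreducibility, at the price of [q] further vertices
    that orient [v]. *)
Lemma irreducible_nbr (g eps : R) v s Z : irreducible e k g eps -> (#|s| + q <= k)%N ->
  v \notin s -> definable e s Z -> mu (nbr v :\: Z) <= eps -> 1 / 2 - g < mu Z.
Proof.
move=> irr sq vs sZ vZ; have [D [Dv Dq Dor]] := orients_exists v.
apply: (irr v (s :|: D)) => //.
- by rewrite (leq_trans (leq_card_setU _ _))// (leq_trans _ sq)// leq_add2l.
- by rewrite inE negb_or vs nbr_notin.
- by apply: orientsS Dor; exact: subsetUr.
- by apply: definableS sZ; exact: subsetUl.
Qed.

(** By triangle-freeness [nbr v] avoids [nbrs Q], so the complement of [nbrs Q] confines the
    neighbourhood of [v] and must be large. *)
Lemma density_nbrs_lt v Q : Q \subset nbr v -> (#|Q| <= 2 * q)%N ->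
  mu (nbrs Q) < 1 / 2 + d.
Proof.
move=> Qv Qq.
have := @irreducible_nbr d er v Q (~: nbrs Q) irr_d; rewrite densityC// => h.
suff : 1 / 2 - d < 1 - mu (nbrs Q) by lra.
apply: h; last 1 first.
- by rewrite setDE setCK (nbr_disjoint_nbrs he Qv) /density cards0 mul0r ltW.
- by move: qk Qq q_gt0; lia.
- exact: nbr_notin.
- by apply: definableC; exact: definable_nbrs.
Qed.

(** In a bipartite graph [nbrs Q] would be almost the whole side of [v]. *)
Definition full v Q := [/\ Q \subset nbr v, (#|Q| <= q)%N & 1 / 2 - d < mu (nbrs Q)].

(** Irreducibility is applied not to [v] but to a neighbour outside [Q], whose own neighbours lie
    almost all in [nbrs Q]. Keeping [x] out of [Q] allows irreducibility to be applied at [x] in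
    [full_adj]. *)
Lemma full_exists v x : exists Q, full v Q /\ x \notin Q.
Proof.
have [Q [QS Qq Qer]] := greedy_cover (nbr v :\ x) T0 er0 erq.
exists Q; split; last by apply/negP => /(subsetP QS); rewrite !inE eqxx.
split=> //; first by apply: subset_trans QS _; rewrite subD1set.
have : 0 < mu (nbr v :\ x :\: Q).
  have := mindeg v; have [_ [_ b]] := d0_gt.
  have := densityID R (nbr v) [set x]; have := densityID R (nbr v :\ x) Q.
  have := densityS R (subsetIr (nbr v) [set x]); have := densityS R (subsetIr (nbr v :\ x) Q).
  have := density_card Qq; rewrite density_set1.
  move: b; move: (1 / _) (_ / _) => ? ?; lra.
case/density_gt0 => u /setDP[uS uQ].
apply: (@irreducible_nbr _ er u Q) => //; last exact: Qer.
- by move: qk Qq; lia.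
- exact: definable_nbrs.
Qed.

(** [density_nbrs_lt] still applies to [u |: Q], so [u] adds less than [2 * d] to a density already
    above [1 / 2 - d]. *)
Lemma full_nbr v Q u : full v Q -> u \in nbr v -> mu (nbr u :\: nbrs Q) <= 2 * d.
Proof.
case=> Qv Qq Qd uv.
have := @density_nbrs_lt v (u |: Q); rewrite subUset sub1set uv Qv nbrsU nbrs1 => /(_ isT).
have -> : (#|u |: Q| <= 2 * q)%N.
  by rewrite cardsU1; move: Qq q_gt0; case: (_ \notin _); lia.
move=> /(_ isT); rewrite (densityID _ _ (nbrs Q)) setUC setUK setDUl setDv set0U.
by move: Qd; lra.
Qed.

Lemma full_full v Q Q' : full v Q -> full v Q' -> mu (nbrs Q :\: nbrs Q') <= 2 * d.
Proof.
case=> Qv Qq Qd [Qv' Qq' Qd'].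
have := @density_nbrs_lt v (Q :|: Q'); rewrite subUset Qv Qv' nbrsU => /(_ isT).
have -> : (#|Q :|: Q'| <= 2 * q)%N.
  by rewrite cardsU; move: Qq Qq'; lia.
move=> /(_ isT); rewrite (densityID _ _ (nbrs Q')) setUC setUK setDUl setDv set0U.
by move: Qd'; lra.
Qed.

(** Up to [2 * d], the neighbours of [v] lie in [nbrs Q1], and none lies in [nbrs Q']. So
    [nbrs Q1 :\: nbrs Q'] confines them and must nearly fill [nbrs Q1]. Replacing [Q1] by [Q] costs
    another [2 * d]. *)
Lemma full_adj u v Q Q' : adj u v -> full u Q -> full v Q' ->
  mu (nbrs Q :&: nbrs Q') <= 3 * d + ge.
Proof.
move=> uv fQ fQ'; have [Q1 [fQ1 vQ1]] := full_exists u v.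
have uv' : v \in nbr u by rewrite inE.
have h : 1 / 2 - ge < mu (nbrs Q1 :\: nbrs Q').
  have [Qv' Qq' _] := fQ'; have [_ Qq1 _] := fQ1.
  apply: (@irreducible_nbr _ (2 * d) v (Q1 :|: Q')) => //.
  - rewrite cardsU; move: Qq1 Qq' qk; lia.
  - by rewrite inE negb_or vQ1 nbr_notin.
  - by apply: definableD; apply: definable_nbrs; rewrite ?subsetUl ?subsetUr.
  - rewrite setDDr (nbr_disjoint_nbrs he Qv') setU0; exact: full_nbr fQ1 uv'.
have := densityID R (nbrs Q1) (nbrs Q').
have : mu (nbrs Q1) < 1 / 2 + d.
  by case: fQ1 => a b _; apply: density_nbrs_lt a _; move: b; lia.
have := full_full fQ fQ1.
have : mu (nbrs Q :&: nbrs Q') <= mu (nbrs Q :\: nbrs Q1) + mu (nbrs Q1 :&: nbrs Q').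
  have := densityUI R (nbrs Q :\: nbrs Q1) (nbrs Q1 :&: nbrs Q').
  have := density_ge0 R ((nbrs Q :\: nbrs Q1) :&: (nbrs Q1 :&: nbrs Q')).
  have : nbrs Q :&: nbrs Q' \subset (nbrs Q :\: nbrs Q1) :|: (nbrs Q1 :&: nbrs Q').
    by apply/subsetP => x; rewrite !in_setI in_setU in_setD in_setI; do 3!case: (x \in nbrs _).
  move/(densityS R); lra.
lra.
Qed.

End Irreducible.
End Structure.

(** * A bipartition from approximate sides *)

Section Bipartition.
Variables (R : realFieldType) (T : finType) (e : rel T).
Local Notation mu := (density R).
Local Notation nbr := (nbr e).
Local Notation adj := (adj e).
Variables (r : T -> {set T}) (d0 d p : R).
Hypothesis T0 : (0 < #|T|)%N.
Hypothesis r_size : forall v, 1 / 2 - d < mu (r v) < 1 / 2 + d.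
Hypothesis r_adj : forall u v, adj u v -> mu (r u :&: r v) <= p.
Hypothesis r_nbr : forall v w, w \in r v -> exists x, adj v x /\ adj x w.
Hypothesis mindeg : forall v, d0 < mu (nbr v).
Hypothesis dp0 : 2 * d + p <= d0.
Hypothesis dp1 : 9 * p + 11 * d < 1 / 2.
Hypothesis d_ge0 : 0 <= d.
Hypothesis p_ge0 : 0 <= p.

Let density_capD (A B C : {set T}) : mu (A :&: C) <= mu (A :\: B) + mu (B :&: C).
Proof. by have := density_trans R A B (~: C); rewrite !setDE !setCK. Qed.

Let density_CD (A B : {set T}) : mu (~: A :\: B) = 1 - mu A - mu B + mu (A :&: B).
Proof. by rewrite setDE -setCU densityC//; have := densityUI R A B; lra. Qed.

Let r_compl u v : adj u v -> mu (~: r u :\: r v) <= 2 * d + p.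
Proof.
move=> /r_adj uv; rewrite density_CD.
by have /andP[a b] := r_size u; have /andP[a' b'] := r_size v; lra.
Qed.

Let r_two u v w : adj u v -> adj v w -> mu (r u :\: r w) <= 2 * d + 2 * p.
Proof.
move=> /r_adj uv /r_compl vw.
have := density_trans R (r u) (~: r v) (r w); rewrite (setDE _ (~: _)) setCK; lra.
Qed.

(** For an edge [u v], the sets [r u] and [r v] are nearly complementary and approximate the two
    sides. Sorting [w] by closeness of [r w] to [r v], rather than by membership of [w], also places
    the few vertices in neither. *)
Lemma bipartition : exists X : {set T},
  (forall x y, adj x y -> (x \in X) != (y \in X)) /\
  (forall w w', (w \in X) = (w' \in X) -> mu (r w :\: r w') <= 8 * p + 10 * d).
Proof.
have [h0 h1 hd hp] := And4 dp0 dp1 d_ge0 p_ge0.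
have [v _] : exists v, v \in [set: T].
  by apply: (@density_gt0 R); rewrite densityT.
have [u vu] : exists u, u \in nbr v.
  by apply: (@density_gt0 R); have := mindeg v; lra.
have {}vu : adj v u by move: vu; rewrite inE.
have uv : adj u v by rewrite adjC.
pose X := [set w | mu (r w :\: r v) <= 4 * p + 4 * d].
have inXv w : w \in r v -> w \in X.
  by case/r_nbr => x [vx xw]; rewrite inE; have := @r_two w x v; rewrite adjC xw adjC vx; lra.
have inru w : w \in r u -> mu (r w :\: r u) <= 2 * d + 2 * p.
  by case/r_nbr => x [vx xw]; apply: (r_two (v := x)); rewrite adjC.
have XC w : w \notin X -> mu (r w :&: r v) <= 4 * p + 4 * d.
  move=> wX; have wv : w \notin r v by apply: contra wX; exact: inXv.
  have [/inru wu|wu] := boolP (w \in r u).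
    have := density_capD (r w) (r u) (r v); have := r_adj uv; lra.
  (* For [w] in neither set, the degree exceeds what [r v] and [r u] leave uncovered, so some
     neighbour lies in one of them and decides the side of [w]. *)
  have : 0 < mu (nbr w :&: (r v :|: r u)).
    have := densityID R (nbr w) (r v :|: r u); have := mindeg w.
    have : nbr w :\: (r v :|: r u) \subset ~: r v :\: r u.
      by apply/subsetP => z; rewrite !inE negb_or => /andP[/andP[-> ->]].
    move/(densityS R); have := r_compl vu; lra.
  case/density_gt0 => z; rewrite in_setI in_setU => /andP[]; rewrite inE => wz /orP[zv|zu].
    have zX := inXv _ zv; rewrite inE in zX.
    have [x [vx xz]] := r_nbr zv.
    have h : mu (r z :\: r v) <= 2 * d + 2 * p by apply: (r_two (v := x)); rewrite adjC.
    have := density_capD (r v) (r z) (r w); rewrite setIC.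
    have := r_adj wz; rewrite setIC.
    have := densityID R (r v) (r z); have := densityID R (r z) (r v).
    rewrite (setIC (r v) (r z)).
    have /andP[a b] := r_size v; have /andP[a' b'] := r_size z; lra.
  case/negP: wX; rewrite inE.
  have := inru _ zu.
  have := density_trans R (r w) (~: r z) (r v); rewrite (setDE _ (~: _)) setCK density_CD.
  have := r_adj wz.
  have := density_capD (r z) (r u) (r v); have := r_adj uv.
  have /andP[a b] := r_size v; have /andP[a' b'] := r_size z; lra.
have side w w' : (w \in X) = (w' \in X) -> mu (r w :\: r w') <= 8 * p + 10 * d.
  have /andP[a b] := r_size v; have /andP[a' b'] := r_size w'.
  have [wX|wX] := boolP (w \in X) => /esym w'X.
    rewrite !inE in wX w'X.
    have := density_trans R (r w) (r v) (r w').
    have := densityID R (r v) (r w'); have := densityID R (r w') (r v).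
    rewrite (setIC (r v)); lra.
  move/negbT/XC in w'X; move/XC in wX.
  have := density_trans R (r w) (~: r v) (r w'); rewrite (setDE _ (~: _)) setCK density_CD (setIC (r v)).
  lra.
(* Adjacent vertices on one side would have [r x] and [r y] both nearly equal and nearly disjoint:
   [(8 * p + 10 * d) + p + d < 1 / 2] excludes this. *)
exists X; split => // x y xy; apply/eqP => /side.
have := r_adj xy; have := densityID R (r x) (r y); have /andP[a b] := r_size x; lra.
Qed.

End Bipartition.

(** * Orientations of bipartite digraphs *)

Definition layered (T : finType) (e : rel T) (A B : {set T}) :=
  [disjoint A & B] && [forall x, forall y, e x y ==>
    (x \in A) && (y \in B) || (x \in B) && (y \notin A :|: B)].

(* The direction of an edge between [x] in [X] and [y] outside is read off [U],
   which is the set of vertices with few incoming edges. *)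
Definition two_layered (R : realFieldType) (T : finType) (e : rel T) (rho : R)
    (X U : {set T}) :=
  [/\ forall x y, adj e x y -> (x \in X) != (y \in X),
      forall x y, x \in X -> adj e x y -> e x y =
        (if [exists z in X :&: U, adj e z y] && [exists z in X :\: U, adj e z y]
         then x \in U else y \notin U),
      (density R (X :&: U) <= rho \/ density R (X :\: U) <= rho)
    & (density R (~: X :&: U) <= rho \/ density R (~: X :\: U) <= rho)].

Section Orientation.
Variables (R : realFieldType) (T : finType) (e : rel T).
Hypothesis he : hasse_like e.
Local Notation mu := (density R).
Local Notation nbr := (nbr e).
Local Notation adj := (adj e).
Variables (X : {set T}) (d0 d4 k1 rho : R).
Hypothesis T0 : (0 < #|T|)%N.
Hypothesis bip : forall x y, adj x y -> (x \in X) != (y \in X).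
Hypothesis mindeg : forall v, d0 < mu (nbr v).
Hypothesis codeg : forall x y, (x \in X) = (y \in X) -> k1 < mu (nbr x :&: nbr y).
Hypothesis hit : forall w x (s W : {set T}), (w \in X) = (x \in X) -> (#|s| <= 2)%N ->
  w \notin s -> definable e s W -> W \subset nbr x -> d4 <= mu W -> 0 < mu (nbr w :&: W).
Hypothesis d4_gt0 : 0 < d4.
Hypothesis d4d0 : d4 <= d0.
Hypothesis d4k1 : 2 * d4 <= k1.
Hypothesis d4rho : d4 <= k1 * rho ^+ 2.
Hypothesis rho_gt0 : 0 < rho.

Let same y x x' : adj x y -> adj x' y -> (x \in X) = (x' \in X).
Proof. by move=> /bip + /bip; do 3!case: (_ \in X). Qed.

Let outs_adj x y : (y \in outs e x) -> adj x y.
Proof. by rewrite inE adjE => ->. Qed.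

Let ins_adj x y : (y \in ins e x) -> adj x y.
Proof. by rewrite inE adjE => ->; rewrite orbT. Qed.

Section Strong.
Variable x : T.
Hypothesis x_outs : d4 <= mu (outs e x).
Hypothesis x_ins : d4 <= mu (ins e x).

(** If [x -> y -> b], then [b] is adjacent to one of the many [z] with [z -> x], and
    [z -> x -> y -> b] has adjacent ends. The case [a -> y -> x] is dual. *)
Lemma nbr_strong_pure y a b : adj x y -> e a y -> e y b -> False.
Proof.
move=> xy ay yb.
have c2 : (#|[set x]| <= 2)%N by rewrite cards1.
have ix : ins e x \subset nbr x by apply/subsetP => z /ins_adj; rewrite inE.
have ox : outs e x \subset nbr x by apply/subsetP => z /outs_adj; rewrite inE.
have aay : adj a y by rewrite adjE ay.
have aby : adj b y by rewrite adjE yb orbT.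
have [sa sb] := (same aay xy, same aby xy).
case/nbrP: xy => [xy|yx].
  have bx : b \notin [set x].
    by rewrite inE; apply: contraTneq yb => ->; exact: (hasse_asym he).
  have [z] := density_gt0 (hit sb c2 bx (definable_ins (set11 x)) ix x_ins).
  rewrite !inE => /andP[bz zx].
  by have := hasse_path3 he zx xy yb; rewrite adjC bz.
have ax : a \notin [set x].
  by rewrite inE; apply: contraTneq ay => ->; exact: (hasse_asym he).
have [z] := density_gt0 (hit sa c2 ax (definable_outs (set11 x)) ox x_outs).
rewrite !inE => /andP[az xz].
by have := hasse_path3 he ay yx xz; rewrite az.
Qed.

(** Among the many common neighbours of [a] and [b], some [z] is adjacent to [x], hence pure. So [a]
    and [b] both precede [z] or both follow it, and with [a -> y -> b] this gives a path of length 3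
    with adjacent ends. *)
Lemma strong_pure y a b : (y \in X) != (x \in X) -> e a y -> e y b -> False.
Proof.
move=> yx ay yb.
have aay : adj a y by rewrite adjE ay.
have aby : adj b y by rewrite adjE yb orbT.
have [xa|xa] := eqVneq x a; first by apply: (nbr_strong_pure _ ay yb); rewrite xa.
have [xb|xb] := eqVneq x b; first by apply: (nbr_strong_pure _ ay yb); rewrite xb.
have xs : x \notin [set a; b] by rewrite !inE negb_or xa.
have sa : (x \in X) = (a \in X).
  by move/bip: aay; move: yx; do 3!case: (_ \in X).
have c2 : (#|[set a; b]| <= 2)%N by rewrite cards2; case: (_ != _).
have W4 : d4 <= mu (nbr a :&: nbr b).
  by have := codeg (same aay aby); move: d4k1 d4_gt0; lra.
have [z] := density_gt0 (hit sa c2 xs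
  (definableI (definable_nbr (set21 a b)) (definable_nbr (set22 a b))) (subsetIl _ _) W4).
rewrite !inE => /and3P[xz az bz].
have pz c c' : e c z -> e z c' -> False by exact: nbr_strong_pure.
case/nbrP: az => [az|za]; case/nbrP: bz => [bz|zb].
- by have := hasse_path3 he ay yb bz; rewrite adjE az.
- exact: pz az zb.
- exact: pz bz za.
- by have := hasse_path3 he za ay yb; rewrite adjE zb.
Qed.

Lemma strong_layered : exists A B, layered e A B.
Proof.
(* The side of [x] becomes the middle layer; purity splits the other side into sources and sinks. *)
pose B := [set y | (y \in X) == (x \in X)].
pose A := [set y | (y \notin B) && [exists z, e y z]].
exists A, B; apply/andP; split.
  by rewrite disjoint_subset; apply/subsetP => y; rewrite inE => /andP[].
apply/forallP => a; apply/forallP => b; apply/implyP => ab.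
have : adj a b by rewrite adjE ab.
move/bip => sab; have [aB|aB] := boolP (a \in B).
  rewrite in_setU negb_or; have -> : b \notin B.
    by move: sab aB; rewrite !inE; do 3!case: (_ \in X).
  rewrite andbT /=; apply/orP; right; rewrite inE negb_and; apply/orP; right.
  apply/existsPn => z; apply/negP => bz; apply: (strong_pure _ ab bz).
  by move: sab aB; rewrite !inE; do 3!case: (_ \in X).
have -> : b \in B by move: sab aB; rewrite !inE; do 3!case: (_ \in X).
by rewrite inE aB; apply/orP; left; rewrite andbT; apply/existsP; exists b.
Qed.

End Strong.

Section Weak.
Hypothesis weak : forall v, mu (ins e v) < d4 \/ mu (outs e v) < d4.
Let U := [set v | mu (ins e v) < d4].

Let outs_U v : v \notin U -> mu (outs e v) < d4.
Proof. by rewrite inE; case: (weak v) => [->|]. Qed.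

Let ins_U v : v \in U -> mu (ins e v) < d4.
Proof. by rewrite inE. Qed.

Let common x x' (A B : {set T}) : (x \in X) = (x' \in X) ->
  mu A < d4 -> mu B < d4 -> exists y, [/\ adj x y, adj x' y, y \notin A & y \notin B].
Proof.
move=> xx' Ad Bd; suff : 0 < mu ((nbr x :&: nbr x') :\: A :\: B).
  case/density_gt0 => y; rewrite in_setD in_setD in_setI => /and3P[yB yA].
  by rewrite !inE => /andP[? ?]; exists y.
have := codeg xx'; have := densityID R (nbr x :&: nbr x') A.
have := densityID R (nbr x :&: nbr x' :\: A) B.
have := densityS R (subsetIr (nbr x :&: nbr x') A).
have := densityS R (subsetIr (nbr x :&: nbr x' :\: A) B).
by move: d4k1; lra.
Qed.

Let not_ins x y : adj x y -> y \notin ins e x -> e x y.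
Proof. by rewrite inE; case/nbrP => // ->. Qed.

Let not_outs x y : adj x y -> y \notin outs e x -> e y x.
Proof. by rewrite inE; case/nbrP => // ->. Qed.

(** If [x -> y -> x'] with both ends in [U], some common neighbour [z] has [x' -> z], and
    [x -> y -> x' -> z] has adjacent ends. Outside [U] the path is extended at the other end. *)
Lemma same_type x x' y : (x \in U) = (x' \in U) -> adj x y -> adj x' y -> e x y = e x' y.
Proof.
wlog suff : x x' / (x \in U) = (x' \in U) -> adj x y -> adj x' y -> e x y -> e x' y.
  by move=> h xx' xy x'y; apply/idP/idP; apply: h.
move=> xx' xy x'y exy; apply/negPn/negP => nx'y.
have yx' : e y x' by move: x'y nx'y => /nbrP[->|].
have sx := same xy x'y.
have [xU|xU] := boolP (x \in U).
  have x'U : x' \in U by rewrite -xx'.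
  have [z [xz x'z zx zx']] := common sx (ins_U xU) (ins_U x'U).
  have := hasse_path3 he exy yx' (not_ins x'z zx').
  by rewrite xz.
have x'U : x' \notin U by rewrite -xx'.
have [z [xz x'z zx zx']] := common sx (outs_U xU) (outs_U x'U).
have := hasse_path3 he (not_outs xz zx) exy yx'.
by rewrite adjC x'z.
Qed.

(** Some common neighbour [z] satisfies [x -> z -> x']. An edge [y -> x] or [x' -> y] would extend
    this to a path of length 3 with adjacent ends. *)
Lemma diff_type x x' y : x \in U -> x' \notin U -> adj x y -> adj x' y -> e x y /\ e y x'.
Proof.
move=> xU x'U xy x'y.
have [z [xz x'z zx zx']] := common (same xy x'y) (ins_U xU) (outs_U x'U).
have [{}xz {}x'z] := (not_ins xz zx, not_outs x'z zx').
have nyx : ~~ e y x.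
  by apply/negP => yx; have := hasse_path3 he yx xz x'z; rewrite adjC x'y.
have nx'y : ~~ e x' y.
  by apply/negP => exy; have := hasse_path3 he xz x'z exy; rewrite xy.
by split; [move: xy nyx => /nbrP[|->]|move: x'y nx'y => /nbrP[->|]].
Qed.

(** If [y] has neighbours of both kinds, [diff_type] decides. Otherwise [same_type] makes all edges
    at [y] point the same way, and since the degree of [y] exceeds [d4], membership of [y] in [U]
    tells which. *)
Lemma edge_rule (S : {set T}) x y : (forall z, adj z y -> z \in S) -> adj x y -> e x y =
  (if [exists z in S :&: U, adj z y] && [exists z in S :\: U, adj z y]
   then x \in U else y \notin U).
Proof.
move=> Sy xy; case: ifPn => [/andP[/exists_inP[a aU ay] /exists_inP[b bU yb]]|h].
  have {}aU : a \in U by move: aU; rewrite inE => /andP[].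
  have {}bU : b \notin U by move: bU; rewrite inE => /andP[].
  have [xU|xU] := boolP (x \in U).
    by case: (diff_type xU bU xy yb).
  have [_ yx] := diff_type aU xU ay xy.
  by apply/negbTE; exact: (hasse_asym he).
have {h} all z : adj z y -> e z y = e x y.
  move=> zy; apply: same_type => //; apply/eqP; apply: contraNT h => zx.
  have [zS xS] := (Sy _ zy, Sy _ xy).
  by apply/andP; move: zx; case zU: (z \in U); case xU: (x \in U) => // _; split;
    apply/exists_inP; [exists z|exists x|exists x|exists z]; rewrite // ?in_setD ?in_setI ?zS ?xS ?zU ?xU.
have deg := mindeg y.
have [exy|nxy] := boolP (e x y).
  symmetry; apply/negP => /ins_U; have -> : ins e y = nbr y.
    apply/setP => z; rewrite [RHS]inE adjC !inE.
    by apply/idP/idP => [zy|/all->//]; rewrite adjE zy.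
  by move: d4d0; lra.
symmetry; apply/negbTE/negP => /outs_U; have -> : outs e y = nbr y.
  apply/setP => z; rewrite !inE; apply/idP/idP => [yz|]; first by rewrite adjE yz.
  by rewrite adjC => /[dup] /all zy /nbrP[]; rewrite // zy (negbTE nxy).
by move: d4d0; lra.
Qed.

(** Double counting of paths [x - y - x'] with [x] in [P] and [x'] in [M]. Codegrees make them
    numerous; but when [y] has both kinds of neighbours, those in [P] precede it and those in [M]
    follow it, and one of the two kinds has density at most [d4]. *)
Lemma minority (S : {set T}) : (forall x x', x \in S -> x' \in S -> (x \in X) = (x' \in X)) ->
  mu (S :&: U) <= rho \/ mu (S :\: U) <= rho.
Proof.
move=> Sside; apply/orP; rewrite -implyNb -ltNge; apply/implyP => gU.
rewrite leNgt; apply/negP => gD.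
set P := S :&: U in gU; set M := S :\: U in gD.
have [n nE] : exists n : R, n = #|T|%:R by exists #|T|%:R.
have n0 : 0 < n by rewrite nE ltr0n.
have cardE (A : {set T}) : #|A|%:R = n * mu A by rewrite mulrC nE divfK// -nE gt_eqF.
have key y : mu (nbr y :&: P) * mu (nbr y :&: M) <= d4.
  have le1 (A : {set T}) : mu A <= 1 by rewrite -(densityT R T0) densityS// subsetT.
  have [P0|/set0Pn[a]] := eqVneq (nbr y :&: P) set0.
    by rewrite P0 /density cards0 !mul0r ltW.
  have [M0|/set0Pn[b]] := eqVneq (nbr y :&: M) set0.
    by rewrite M0 /density cards0 mul0r mulr0 ltW.
  rewrite !inE => /and3P[yb bU bS] /and3P[ya aS aU].
  rewrite -/U in aU bU.
  have [yU|yU] := boolP (y \in U).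
    have h : mu (nbr y :&: P) <= d4.
      apply: le_trans (ltW (ins_U yU)); apply: densityS; apply/subsetP => z.
      rewrite !inE => /and3P[yz zS zU].
      by apply: (diff_type (x' := b) _ _ _ _).1 => //; rewrite ?inE// adjC.
    rewrite (le_trans (ler_wpM2l (density_ge0 _ _) (le1 _)))// mulr1//.
  have h : mu (nbr y :&: M) <= d4.
    apply: le_trans (ltW (outs_U yU)); apply: densityS; apply/subsetP => z.
    rewrite !inE => /and3P[yz zU zS].
    by apply: (diff_type (x := a) _ _ _ _).2 => //; rewrite ?inE// adjC.
  rewrite (le_trans (ler_wpM2r (density_ge0 _ _) (le1 _)))// mul1r//.
have E : \sum_(x in P) \sum_(x' in M) (#|nbr x :&: nbr x'|%:R : R) =
         \sum_y #|nbr y :&: P|%:R * #|nbr y :&: M|%:R.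
  have cE y (A : {set T}) : #|nbr y :&: A|%:R = \sum_(x in A) (adj x y)%:R :> R.
    rewrite -natr_sum; congr (_%:R); rewrite -sum1_card [LHS]big_mkcond [RHS]big_mkcond/=.
    by apply: eq_bigr => x _; rewrite !inE adjC; case: (x \in A); case: (adj _ _).
  have cE2 x x' : #|nbr x :&: nbr x'|%:R = \sum_y (adj x y)%:R * (adj x' y)%:R :> R.
    under eq_bigr do rewrite -natrM mulnb.
    rewrite -natr_sum; congr (_%:R); rewrite -sum1_card [LHS]big_mkcond/=.
    by apply: eq_bigr => y _; rewrite !inE; case: (_ && _).
  under eq_bigr do under eq_bigr do rewrite cE2.
  under eq_bigr do rewrite exchange_big.
  rewrite exchange_big; apply: eq_bigr => y _.
  by rewrite !cE big_distrlr.
have lower : n ^+ 3 * (mu P * mu M * k1) <= \sum_(x in P) \sum_(x' in M) #|nbr x :&: nbr x'|%:R.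
  have -> : n ^+ 3 * (mu P * mu M * k1) = \sum_(x in P) \sum_(x' in M) (n * k1).
    under eq_bigr do rewrite sumr_const -mulr_natr cardE.
    by rewrite sumr_const -mulr_natr cardE; ring.
  apply: ler_sum => x xP; apply: ler_sum => x' x'M; rewrite cardE ler_pM2l//.
  apply/ltW/codeg/Sside; first by move: xP; rewrite inE => /andP[].
  by move: x'M; rewrite inE => /andP[].
have upper : \sum_y #|nbr y :&: P|%:R * #|nbr y :&: M|%:R <= n ^+ 3 * d4.
  have -> : n ^+ 3 * d4 = \sum_(y : T) (n ^+ 2 * d4).
    by rewrite sumr_const -mulr_natr -nE; ring.
  apply: ler_sum => y _; rewrite !cardE.
  have -> : n * mu (nbr y :&: P) * (n * mu (nbr y :&: M)) =
    n ^+ 2 * (mu (nbr y :&: P) * mu (nbr y :&: M)) by ring.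
  by rewrite ler_pM2l ?exprn_gt0.
have k1_gt0 : 0 < k1 by move: d4k1 d4_gt0; lra.
have : mu P * mu M * k1 <= d4.
  by rewrite -(ler_pM2l (exprn_gt0 3 n0)) (le_trans lower)// E.
have : rho ^+ 2 < mu P * mu M by rewrite expr2 ltr_pM// ltW.
rewrite -(ltr_pM2r k1_gt0); move: d4rho; rewrite mulrC; lra.
Qed.

Lemma weak_two_layered : two_layered e rho X U.
Proof.
split => //.
- move=> x y xX xy; apply: edge_rule => // z zy.
  by rewrite (same zy xy).
- by apply: minority => x x' -> ->.
- by apply: minority => x x'; rewrite !inE => /negbTE-> /negbTE->.
Qed.

End Weak.

Lemma dichotomy : (exists A B, layered e A B) \/ (exists U, two_layered e rho X U).
Proof.
have [/existsP[x /andP[xo xi]]|/existsPn h] :=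
    boolP [exists x, (d4 <= mu (outs e x)) && (d4 <= mu (ins e x))].
  by left; exact: (strong_layered xo xi).
right; eexists; apply: weak_two_layered => v.
by have := h v; rewrite negb_and -!ltNge => /orP[]; [right|left].
Qed.

End Orientation.

(** The first two irreducibility conditions produce the approximate sides [r v], the third the
    codegrees, the fourth the hitting property. Since [s] may have [2 * q] elements before the [q]
    orienting ones are added, [k] is at least [3 * q]. *)
Lemma irreducible_dichotomy (R : realFieldType) (T : finType) (e : rel T)
    (q k : nat) (d0 d er ge k1 d4 rho : R) :
  hasse_like e -> (0 < #|T|)%N -> (3 * q + 2 <= k)%N ->
  (forall v, d0 < density R (nbr e v)) ->
  0 < er -> er^-1 <= q%:R -> q.+2%:R / #|T|%:R + er < d0 ->
  irreducible e k d er -> irreducible e k ge (2 * d) ->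
  irreducible e k (d0 / 2) k1 -> irreducible e k (d4 / 2) 0 ->
  0 <= d <= ge -> 200 * ge <= d4 -> 0 < d4 -> 2 * d4 <= k1 -> k1 <= d0 <= 1 ->
  d4 <= k1 * rho ^+ 2 -> 0 < rho ->
  (exists A B, layered e A B) \/ (exists X U, two_layered e rho X U).
Proof.
move=> he T0 qk mindeg er0 erq big irr_d irr_ge irr_0 irr_4 /andP[d_ge0 dge] ged4 d4_gt0 d4k1
  /andP[k1d0 d01] d4rho rho0.
have irrn := irreducible_nbr he T0 mindeg er0 erq big.
have [f fF] : exists f : T -> {set T}, forall v, full e q d v (f v).
  apply: (@fin_all_exists _ _ (fun v Q => full e q d v Q)) => v.
  by have [Q [fQ _]] := full_exists he T0 qk mindeg er0 erq big irr_d v v; exists Q.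
pose r v := nbrs e (f v).
pose p := 3 * d + ge.
have r_size v : 1 / 2 - d < density R (r v) < 1 / 2 + d.
  have [fv fq ->/=] := fF v.
  by apply: (density_nbrs_lt he T0 qk mindeg er0 erq big irr_d fv); rewrite (leq_trans fq)// leq_pmull.
have r_adj u v : adj e u v -> density R (r u :&: r v) <= p.
  by move=> uv; exact: (full_adj he T0 qk mindeg er0 erq big irr_d irr_ge uv).
have r_nbr v w : w \in r v -> exists x, adj e v x /\ adj e x w.
  rewrite inE => /exists_inP[x xf xw]; exists x; split => //.
  by have [/subsetP/(_ _ xf)] := fF v; rewrite inE.
have r_disj v : nbr e v :&: r v = set0.
  by apply: nbr_disjoint_nbrs => //; case: (fF v).
have [||||X [bip side]] := bipartition T0 r_size r_adj r_nbr mindeg.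
- by rewrite /p; lra.
- by rewrite /p; lra.
- by [].
- by rewrite /p; lra.
(* [W] lies in [nbr x], hence outside [r x] and almost outside [r w]; if [nbr w] nearly avoided [W]
   too, the complement of [r w :|: W] would be too small a set confining it. The 43 bounds
   [8 * p + 10 * d + d] with [p <= 4 * ge] and [d <= ge]. *)
have hit (g eps kap : R) : irreducible e k g eps -> 43 * ge + g <= kap ->
  forall w x (s W : {set T}), (w \in X) = (x \in X) -> (#|s| <= 2)%N ->
  w \notin s -> definable e s W -> W \subset nbr e x -> kap <= density R W ->
  eps < density R (nbr e w :&: W).
  move=> irr gk w x s W wx s2 ws sW Wx kW; rewrite ltNge; apply/negP => small.
  have [fv fq _] := fF w.
  have : 1 / 2 - g < density R (~: (r w :|: W)).
    apply: (irrn _ _ _ w (f w :|: s) _ irr).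
    - by rewrite cardsU; move: fq s2 qk; clear; lia.
    - by rewrite inE negb_or ws (nbr_notin he fv).
    - apply/definableC/definableU; last by apply: definableS sW; exact: subsetUr.
      by apply: definable_nbrs; exact: subsetUl.
    - by rewrite setDE setCK setIUr r_disj set0U.
  rewrite densityC//; have := densityUI R (r w) W.
  have : r w :&: W \subset r w :\: r x.
    apply/subsetP => z /setIP[zw zW]; rewrite in_setD zw andbT.
    apply/negP => zx; have : z \in nbr e x :&: r x by rewrite in_setI (subsetP Wx).
    by rewrite r_disj inE.
  move/(densityS R); have := side _ _ wx; have /andP[] := r_size w.
  by rewrite /p; lra.
have codeg x y : (x \in X) = (y \in X) -> k1 < density R (nbr e x :&: nbr e y).
  have [->|xy] := eqVneq x y; first by rewrite setIid; have := mindeg y; lra.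
  move=> sxy; apply: (hit _ _ d0 irr_0 _ x y [set y]) => //.
  - lra.
  - by rewrite cards1.
  - by rewrite inE.
  - by apply: definable_nbr; rewrite set11.
  - exact/ltW.
have d4d0 : d4 <= d0 by lra.
have g4 : 43 * ge + d4 / 2 <= d4 by lra.
have [h|[U h]] := dichotomy he T0 bip mindeg codeg (hit _ _ _ irr_4 g4) d4_gt0 d4d0 d4k1 d4rho rho0.
  by left.
by right; exists X, U.
Qed.

(** * Counting by deletion of a vertex *)

Definition hasse_set (T : finType) : {set {set T * T}} :=
  [set E | `[< hasse_like (rel_of E) >]].

Lemma hasse_setP (T : finType) (E : {set T * T}) :
  reflect (hasse_like (rel_of E)) (E \in hasse_set T).
Proof. by rewrite inE; exact: asboolP. Qed.

Lemma card_cover_le (R : realFieldType) (I X : finType) (A : {set X}) (J : {set I})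
    (F : I -> {set X}) (M : R) :
  (forall x, x \in A -> exists2 i, i \in J & x \in F i) ->
  (forall i, i \in J -> #|F i|%:R <= M) -> #|A|%:R <= #|J|%:R * M.
Proof.
move=> AF FM.
have h : (#|A| <= \sum_(i in J) #|F i|)%N.
  apply: (@leq_trans #|\bigcup_(i in J) F i|).
    apply: subset_leq_card; apply/subsetP => x /AF[i iJ xF].
    by apply/bigcupP; exists i.
  apply: (big_ind2 (fun (B : {set X}) m => #|B| <= m)%N); first by rewrite cards0.
    by move=> B m C p Bm Cp; rewrite cardsU (leq_trans (leq_subr _ _))// leq_add.
  by [].
apply: (@le_trans _ _ (\sum_(i in J) #|F i|)%:R); first by rewrite ler_nat.
rewrite natr_sum mulr_natl -sumr_const; exact: ler_sum.
Qed.

Section DeleteVertex.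
Variables (n : nat) (v : 'I_n.+1).
Implicit Types E : {set 'I_n.+1 * 'I_n.+1}.

Definition del E : {set 'I_n * 'I_n} := [set p | (lift v p.1, lift v p.2) \in E].

Lemma rel_del E x y : rel_of (del E) x y = rel_of E (lift v x) (lift v y).
Proof. by rewrite /rel_of inE. Qed.

Lemma hasse_del E : hasse_like (rel_of E) -> hasse_like (rel_of (del E)).
Proof.
move=> [h2 h3]; split=> [x y z|x y z w]; rewrite !rel_del; [exact: h2|exact: h3].
Qed.

Lemma del_off E E' x y : del E = del E' -> x != v -> y != v ->
  rel_of E x y = rel_of E' x y.
Proof.
rewrite eq_sym (eq_sym y) => dE xv yv.
have [x' -> _] := unlift_some xv; have [y' -> _] := unlift_some yv.
by rewrite -!rel_del dE.
Qed.

Lemma del_inj E E' : del E = del E' -> outs (rel_of E) v = outs (rel_of E') v ->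
  ins (rel_of E) v = ins (rel_of E') v -> E = E'.
Proof.
move=> dE oE iE; apply/setP => -[x y].
have [->|xv] := eqVneq x v; first by have /setP/(_ y) := oE; rewrite !inE.
have [->|yv] := eqVneq y v; first by have /setP/(_ x) := iE; rewrite !inE.
exact: (del_off dE xv yv).
Qed.

Lemma del_orients_inj E E' (s : {set 'I_n.+1}) :
  hasse_like (rel_of E) -> hasse_like (rel_of E') -> del E = del E' ->
  v \notin s -> orients (rel_of E) s v -> nbr (rel_of E) v = nbr (rel_of E') v ->
  {in s, forall q, rel_of E v q = rel_of E' v q} -> E = E'.
Proof.
move=> hE hE' dE vs os nE qE.
have aE w : adj (rel_of E) v w = adj (rel_of E') v w.
  by have /setP/(_ w) := nE; rewrite !inE.
have offE x y : x != v -> y != v -> adj (rel_of E) x y = adj (rel_of E') x y.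
  by move=> xv yv; rewrite /adj !(del_off dE).
have notv w : adj (rel_of E) v w -> w != v.
  by apply: contraTneq => ->; rewrite adjxx.
have oE w : rel_of E v w = rel_of E' v w.
  have [vw|vw] := boolP (adj (rel_of E) v w); last first.
    have := vw; rewrite aE; move: vw; rewrite /adj !negb_or.
    by move=> /andP[/negbTE-> _] /andP[/negbTE->].
  have [q [z [qs vq zv qz wz]]] := os _ vw.
  have [wv qv] := (notv _ vw, notv _ vq).
  (* In the 4-cycle [v q z w], the edges at [z] survive the deletion of [v], and the direction of
     [v q] is given by [qE]. *)
  rewrite (hasse_square hE vq qz wz vw).
  have vq' : adj (rel_of E') v q by rewrite -aE.
  have qz' : adj (rel_of E') q z by rewrite -offE.
  have wz' : adj (rel_of E') w z by rewrite -offE.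
  have vw' : adj (rel_of E') v w by rewrite -aE.
  by rewrite (hasse_square hE' vq' qz' wz' vw') qE// !(del_off dE _ zv).
apply: del_inj => //; apply/setP => w; rewrite !inE; first exact: oE.
change (rel_of E w v = rel_of E' w v).
have [vw|vw] := boolP (adj (rel_of E) v w).
  by rewrite (adj_rev hE vw) (adj_rev hE') -?aE// oE.
have := vw; rewrite aE; move: vw; rewrite /adj !negb_or.
by move=> /andP[_ /negbTE->] /andP[_ /negbTE->].
Qed.

Lemma card_del (R : realFieldType) (Phi : {set {set 'I_n.+1 * 'I_n.+1}}) (M : R) :
  Phi \subset hasse_set _ ->
  (forall E0 : {set _}, #|[set E in Phi | del E == E0]|%:R <= M) ->
  #|Phi|%:R <= #|hasse_set 'I_n|%:R * M.
Proof.
move=> /subsetP PhiH fib.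
apply: (@card_cover_le _ _ _ _ _ (fun E0 : {set _} => [set E in Phi | del E == E0])) => // E EPhi.
exists (del E); last by rewrite inE EPhi eqxx.
by apply/hasse_setP/hasse_del/hasse_setP/PhiH.
Qed.

End DeleteVertex.

Lemma card_set_of (T : finType) : #|{set T}| = (2 ^ #|T|)%N.
Proof. by rewrite -[LHS]cardsT -powersetT card_powerset cardsT. Qed.

(** * Sets of small density *)

Section SmallSets.
Variable R : realType.

Definition small (T : finType) (t : R) : {set {set T}} := [set A | density R A <= t].

(** Each small [A] contributes at least [x ^ (t n)] to the sum of all [x ^ #|A|], which is
    [(1 + x) ^ n]. *)
Lemma card_small_le (T : finType) (x t : R) : 0 < x <= 1 ->
  #|small T t|%:R * (x `^ (t * #|T|%:R)) <= (1 + x) ^+ #|T|.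
Proof.
move=> /andP[x0 x1].
have [T0|T0] := posnP #|T|.
  rewrite T0 mulr0 powRr0 mulr1 expr0 (_ : 1 = 1%:R)// ler_nat.
  by rewrite (leq_trans (max_card _))// card_set_of T0.
have -> : (1 + x) ^+ #|T| = \sum_(A : {set T}) x ^+ #|A|.
  rewrite addrC -(cardsT T) -prodr_const.
  rewrite (eq_bigl xpredT); last by move=> i; rewrite inE.
  rewrite bigA_distr; apply: eq_bigr => A _.
  by rewrite -big_mkcond/= prodr_const.
rewrite mulr_natl -sumr_const big_mkcond; apply: ler_sum => A _.
rewrite inE; case: ifP => [At|_]; last by rewrite exprn_ge0// ltW.
rewrite -powR_mulrn ?(ltW x0)//.
rewrite /powR gt_eqF// ler_expR ler_wnM2r ?ln_le0//.
by rewrite -ler_pdivrMr ?ltr0n.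
Qed.

Lemma small_bound (g : R) : 0 < g -> exists2 eps, 0 < eps <= 1 &
  forall T : finType, #|small T eps|%:R <= 2 `^ (g * #|T|%:R).
Proof.
(* The choice of [x] gives [1 + x <= expR a], and that of [eps] gives [- eps * ln x <= a]; the
   exponent [2 * a * n] is that of [2 ^ (g n)]. *)
move=> g0; pose a := g / 2 * ln 2.
have ln2 : 0 < ln 2 :> R by rewrite ln_gt0// ltr1n.
have a0 : 0 < a by rewrite mulr_gt0// divr_gt0.
have a1 : 0 < 1 + a by rewrite addr_gt0.
pose x := a / (1 + a).
have x0 : 0 < x by rewrite divr_gt0.
have x1 : x <= 1 by rewrite ler_pdivrMr// mul1r lerDr.
have lx : ln x <= 0 by rewrite ln_le0.
have b0 : 0 < 1 + a - ln x by rewrite ltr_wpDr ?oppr_ge0.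
pose eps := a / (1 + a - ln x).
have e0 : 0 < eps by rewrite divr_gt0.
have e1 : eps <= 1 by rewrite ler_pdivrMr// mul1r -addrA (addrCA 1) lerDl subr_ge0 (le_trans lx).
exists eps => [|T]; first by rewrite e0.
have := @card_small_le T x eps; rewrite x0 x1 => /(_ isT).
rewrite -ler_pdivlMr ?powR_gt0// => /le_trans; apply.
rewrite /powR (gt_eqF x0) pnatr_eq0/= -expRN.
have xa : 1 + x <= expR a.
  by apply: (le_trans _ (expR_ge1Dx a)); rewrite lerD2l ler_pdivrMr// mulrDr mulr1 lerDl mulr_ge0 ?ltW//.
have -> : g * #|T|%:R * ln 2 = a * #|T|%:R + a * #|T|%:R by rewrite /a; field.
rewrite expRD ler_pM//.
- by rewrite exprn_ge0// addr_ge0// ltW.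
- by rewrite expRM_natr lerXn2r// nnegrE ?expR_ge0// addr_ge0// ltW.
rewrite ler_expR mulrAC -mulNr ler_wpM2r// -mulrN.
rewrite /eps mulrAC ler_pdivrMr// ler_pM2l// lerDr ltW//.
Qed.

End SmallSets.

Lemma leq_card_in_inj (X Y : finType) (f : X -> Y) (A : {set X}) (B : {set Y}) :
  {in A &, injective f} -> (forall x, x \in A -> f x \in B) -> (#|A| <= #|B|)%N.
Proof.
move=> finj fAB; rewrite -(card_in_imset finj) subset_leq_card//.
by apply/subsetP => _ /imsetP[x xA ->]; exact: fAB.
Qed.

(** * Digraphs failing a degree or irreducibility condition *)

Section ReducibleCounts.
Variables (R : realType) (n : nat).
Local Notation T := 'I_n.+1.

(** Here no directions are forced, so out- and in-neighbourhoods are recorded separately, whence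
    [M * M]. *)
Lemma card_low_degree (d0 M : R) : #|small T d0|%:R <= M ->
  #|[set E in hasse_set T | [exists v, density R (nbr (rel_of E) v) <= d0]]|%:R
  <= n.+1%:R * (#|hasse_set 'I_n|%:R * (M * M)).
Proof.
move=> sM; rewrite -[X in X%:R * _]card_ord -cardsT.
pose F v := [set E in hasse_set T | density R (nbr (rel_of E) v) <= d0].
apply: (card_cover_le (F := F)) => [E|v _].
  by rewrite inE => /andP[hE /existsP[v Ev]]; exists v; [exact: in_setT|by rewrite inE hE].
apply: (card_del (v := v)) => [|E0].
  by apply/subsetP => E; rewrite inE => /andP[].
have M0 : 0 <= M by apply: le_trans sM.
apply: (@le_trans _ _ (#|setX (small T d0) (small T d0)|%:R)); last first.
  by rewrite cardsX natrM ler_pM.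
rewrite ler_nat; apply: (@leq_card_in_inj _ _ (fun E => (outs (rel_of E) v, ins (rel_of E) v))).
  move=> E E'; rewrite !inE => /andP[_ /eqP dE] /andP[_ /eqP dE'] [oE iE].
  by apply: (@del_inj _ v) => //; rewrite dE.
move=> E; rewrite !inE => /andP[/andP[_ h] _].
by apply/andP; split; apply: le_trans h; apply: densityS; rewrite nbrU ?subsetUl ?subsetUr.
Qed.

Variable k : nat.

(** [None] is padding: sets of at most [k] vertices are coded by [k]-tuples of options. *)
Definition slot (e : rel T) (o : option T) (w : T) : bool * bool :=
  if o is Some q then (e q w, e w q) else (false, false).

Definition pattern (e : rel T) (t : k.-tuple (option T)) (w : T) :=
  [tuple slot e (tnth t i) w | i < k].

Definition elements (t : k.-tuple (option T)) : {set T} := [set q | Some q \in t].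

(** Leaving out [v] makes this set depend only on the digraph with [v] deleted, provided [v] is no
    entry of [t]. *)
Definition chosen (e : rel T) (v : T) (t : k.-tuple (option T))
    (Pi : {set k.-tuple (bool * bool)}) :=
  [set w | (w != v) && (pattern e t w \in Pi)].

Definition directions (e : rel T) (v : T) (t : k.-tuple (option T)) : {set 'I_k} :=
  [set i | if tnth t i is Some q then e v q else false].

Lemma elements_exists (s : {set T}) : (#|s| <= k)%N -> exists t, elements t = s.
Proof.
move=> sk; exists [tuple nth None [seq Some q | q <- enum s] i | i < k].
apply/setP => q; rewrite inE; apply/mapP/idP => [[i _ qi]|qs].
  have : (i < size [seq Some q | q <- enum s])%N.
    by rewrite ltnNge; apply/negP => h; move: qi; rewrite nth_default.
  by move/(mem_nth None); rewrite -qi => /mapP[q' + [->]]; rewrite mem_enum.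
have qs' : (index q (enum s) < #|s|)%N by rewrite cardE index_mem mem_enum.
exists (Ordinal (leq_trans qs' sk)); rewrite ?mem_enum//=.
by rewrite (nth_map q) -?cardE// nth_index// mem_enum.
Qed.

Lemma pattern_eq (e : rel T) t w w' : pattern e t w = pattern e t w' ->
  {in elements t, forall q, e q w = e q w' /\ e w q = e w' q}.
Proof.
move=> ww' q; rewrite inE => /tnthP[i qi].
have := congr1 (fun p => tnth p i) ww'; rewrite !tnth_mktuple /slot -qi.
by case.
Qed.

Lemma chosen_exists (e : rel T) v (t : k.-tuple (option T)) (Z : {set T}) :
  definable e (elements t) Z -> exists Pi, chosen e v t Pi = Z :\ v.
Proof.
move=> dZ; exists [set pattern e t w | w in Z]; apply/setP => w; rewrite !inE.
case: (w != v) => //=; apply/imsetP/idP => [[w' w'Z /pattern_eq ww']|wZ].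
  by rewrite (dZ _ _ ww').
by exists w.
Qed.

(** The index records [v], a tuple for [s], the patterns making up [Z], and the directions from [v]
    to [s]: polynomially many choices. Given these and the rest of the digraph, only the part of
    [nbr v] inside [Z] and a small part outside are free. *)
Lemma card_reducible (g eps M : R) : #|small T eps|%:R <= M ->
  #|[set E in hasse_set T | ~~ `[< irreducible (rel_of E) k g eps >]]|%:R <=
  (n.+1 * (n.+2 ^ k * (2 ^ (4 ^ k) * 2 ^ k)))%:R *
    (#|hasse_set 'I_n|%:R * (2 `^ ((1 / 2 - g) * n.+1%:R) * M)).
Proof.
move=> sM; have M0 : 0 <= M by apply: le_trans sM.
pose good (E : {set T * T}) v t Pi := [/\ E \in hasse_set T, v \notin elements t,
  orients (rel_of E) (elements t) v,
  density R (nbr (rel_of E) v :\: chosen (rel_of E) v t Pi) <= eps &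
  density R (chosen (rel_of E) v t Pi) <= 1 / 2 - g].
pose F (i : T * (k.-tuple (option T) * ({set k.-tuple (bool * bool)} * {set 'I_k}))) :=
  [set E | `[< good E i.1 i.2.1 i.2.2.1 /\ directions (rel_of E) i.1 i.2.1 = i.2.2.2 >]].
have -> : (n.+1 * (n.+2 ^ k * (2 ^ (4 ^ k) * 2 ^ k)) = #|[set: (T * (k.-tuple (option T) *
     ({set k.-tuple (bool * bool)} * {set 'I_k})))%type]|)%N.
  rewrite cardsT !card_prod !card_set_of !card_tuple !card_option !card_prod card_bool !card_ord.
  by [].
apply: (card_cover_le (F := F)) => [E|[v [t [Pi be]]] _].
  rewrite inE => /andP[hE /asboolPn]; rewrite /irreducible.
  move/existsNP => [v /existsNP[s /existsNP[Z]]].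
  move=> /not_implyP[sk /not_implyP[vs /not_implyP[os /not_implyP[dZ /not_implyP[small /negP]]]]].
  rewrite -leNgt => Zle.
  have [t ts] := elements_exists sk; rewrite -ts in vs os dZ.
  have [Pi PiZ] := chosen_exists v dZ.
  exists (v, (t, (Pi, directions (rel_of E) v t))); rewrite ?in_setT// inE; apply/asboolP.
  split => //=; split => //; rewrite PiZ.
    apply: le_trans small; apply: densityS; apply/subsetP => w; rewrite !inE.
    case: (eqVneq w v) => [->|//]; first by rewrite adjxx ?andbF//; exact/hasse_setP.
  by apply: le_trans Zle; apply: densityS; rewrite subD1set.
apply: (card_del (v := v)) => [|E0].
  by apply/subsetP => E; rewrite inE => /asboolP[[]].
(* [Z1] is read off one member of the fibre; [ZE] shows that all members give the same set. *)
have [->|/set0Pn[E1]] := eqVneq [set E in F (v, (t, (Pi, be))) | del v E == E0] set0.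
  by rewrite cards0 mulr_ge0// powR_ge0.
rewrite inE => /andP[]; rewrite inE => /asboolP[/= [hE1 vt1 _ _ Z1le] _] /eqP dE1.
set Z1 := chosen _ _ _ _ in Z1le.
have ZE E : del v E = E0 -> chosen (rel_of E) v t Pi = Z1.
  move=> dE; apply/setP => w; rewrite !inE; have [//|wv/=] := eqVneq w v.
  congr (_ \in Pi); apply: eq_from_tnth => i; rewrite !tnth_mktuple /slot.
  case ti : (tnth t i) => [q|//].
  have qv : q != v.
    apply: contraNneq vt1 => <-; rewrite inE -ti; exact: mem_tnth.
  have dd : del v E = del v E1 by rewrite dE.
  by rewrite !(del_off dd).
apply: (@le_trans _ _ (#|setX (powerset Z1) (small T eps)|%:R)); last first.
  rewrite cardsX natrM ler_pM// card_powerset natrX -powR_mulrn//.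
  rewrite ler_powR// ?ler1n// -ler_pdivrMr ?ltr0n// -[X in _ / X%:R <= _]card_ord.
  exact: Z1le.
rewrite ler_nat; apply: (@leq_card_in_inj _ _
  (fun E => (nbr (rel_of E) v :&: Z1, nbr (rel_of E) v :\: Z1))).
  move=> E E'; rewrite 2!inE [E' \in _]inE [E' \in F _]inE.
  move=> /andP[/asboolP[[hE vt oE _ _] dirE] /eqP dE].
  move=> /andP[/asboolP[[hE' _ _ _ _] dirE'] /eqP dE'] [nI nD].
  apply: (@del_orients_inj _ v _ _ (elements t)) => //=; try exact/hasse_setP.
  - by rewrite dE.
  - by rewrite -(setID (nbr (rel_of E) v) Z1) nI nD setID.
  move=> q; rewrite inE => /tnthP[i qi].
  have : (i \in directions (rel_of E) v t) = (i \in directions (rel_of E') v t).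
    by rewrite dirE dirE'.
  by rewrite !inE -qi.
move=> E; rewrite 2!inE => /andP[/asboolP[[_ _ _ + _] _] /eqP dE] /=.
by rewrite (ZE _ dE) in_setX powersetE subsetIr inE.
Qed.

End ReducibleCounts.

(** * Counting layered digraphs *)

Definition dense (T : finType) (e : rel T) (r : nat) (A B : {set T}) :=
  forall S1 S2 : {set T}, S1 \subset A -> S2 \subset B ->
  (r <= #|S1|)%N -> (r <= #|S2|)%N -> exists x y, [/\ x \in S1, y \in S2 & e x y].

Definition nice (R : realFieldType) (T : finType) (e : rel T) (theta : R) (r : nat)
    (A B : {set T}) :=
  [/\ theta < density R A, theta < density R B, theta < density R (~: (A :|: B)),
      dense e r A B & dense e r B (~: (A :|: B))].

Section LayeredCounts.
Variables (R : realType) (T : finType).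
Implicit Types (X U A B C : {set T}) (E : {set T * T}).
Local Notation n := (#|T|%:R : R).

Lemma natr_exp2 (m : nat) : (2 ^ m)%:R = 2 `^ m%:R :> R.
Proof. by rewrite natrX powR_mulrn. Qed.

Lemma card_powersetT : #|[set: {set T}]| = (2 ^ #|T|)%N.
Proof. by rewrite cardsT card_set_of. Qed.

Lemma mul_cardC_le X : (#|X| * #|~: X|)%:R <= n ^+ 2 / 4 :> R.
Proof.
rewrite -(cardsC X) natrM natrD -subr_ge0.
set a : R := #|X|%:R; set b : R := #|~: X|%:R.
rewrite (_ : _ - _ = ((a - b) / 2) ^+ 2) ?sqr_ge0//; by field.
Qed.

Lemma exp2_mul_cardC_le X : (2 ^ (#|X| * #|~: X|))%:R <= 2 `^ (n ^+ 2 / 4) :> R.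
Proof. by rewrite natr_exp2 ler_powR ?ler1n// mul_cardC_le. Qed.

(** The direction rule recovers the digraph from [X], [U] and its undirected edges. On each side [U]
    is a small set or the complement of one, whence [(2 * M) ^ 2]. *)
Lemma card_two_layered (rho M : R) : #|small T rho|%:R <= M ->
  #|[set E in hasse_set T | `[< exists X U, two_layered (rel_of E) rho X U >]]|%:R <=
  2 `^ n * ((2 * M) ^+ 2 * 2 `^ (n ^+ 2 / 4)).
Proof.
move=> sM.
pose J : {set {set T} * ((bool * {set T}) * (bool * {set T}))} :=
  setX setT (setX (setX setT (small T rho)) (setX setT (small T rho))).
have JE : #|J|%:R <= 2 `^ n * (2 * M) ^+ 2.
  rewrite !cardsX !cardsT card_set_of card_bool !natrM natr_exp2 expr2.
  by rewrite ler_wpM2l ?powR_ge0// ler_pM ?mulr_ge0// ler_wpM2l.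
rewrite mulrA (le_trans _ (ler_wpM2r (powR_ge0 _ _) JE))//.
pose cut (S : {set T}) (b : bool) A := if b then A else S :\: A.
pose up (i : {set T} * ((bool * {set T}) * (bool * {set T}))) :=
  cut i.1 i.2.1.1 i.2.1.2 :|: cut (~: i.1) i.2.2.1 i.2.2.2.
pose F (i : {set T} * ((bool * {set T}) * (bool * {set T}))) := [set E in hasse_set T | `[<
  (forall x y, adj (rel_of E) x y -> (x \in i.1) != (y \in i.1)) /\
  (forall x y, x \in i.1 -> adj (rel_of E) x y -> rel_of E x y =
        (if [exists z in i.1 :&: up i, adj (rel_of E) z y] &&
            [exists z in i.1 :\: up i, adj (rel_of E) z y]
         then x \in up i else y \notin up i)) >]].
apply: (card_cover_le (F := F)) => [E|i _].
  rewrite inE => /andP[hE /asboolP[X [U [bip rule mX mC]]]].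
  have cutP (S : {set T}) : density R (S :&: U) <= rho \/ density R (S :\: U) <= rho ->
      exists b A, A \in small T rho /\ cut S b A = S :&: U.
    case=> h; first by exists true, (S :&: U); rewrite inE.
    by exists false, (S :\: U); rewrite inE; split => //=; rewrite setDDr setDv set0U.
  have [b1 [A1 [A1s A1E]]] := cutP _ mX; have [b2 [A2 [A2s A2E]]] := cutP _ mC.
  exists (X, ((b1, A1), (b2, A2))).
    by rewrite !in_setX !in_setT A1s A2s.
  rewrite inE hE; apply/asboolP.
  have -> : up (X, ((b1, A1), (b2, A2))) = U.
    by rewrite /up/= A1E A2E -setIUl setUCr setTI.
  by split.
apply: le_trans (exp2_mul_cardC_le i.1); rewrite ler_nat -cardsX -card_powerset.
pose f E := [set p in setX i.1 (~: i.1) | adj (rel_of E) p.1 p.2].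
apply: (@leq_card_in_inj _ _ f) => [E E'|E _]; last first.
  by rewrite powersetE; apply/subsetP => p; rewrite inE => /andP[].
rewrite inE => /andP[/hasse_setP hE /asboolP[bip rule]].
rewrite inE => /andP[/hasse_setP hE' /asboolP[bip' rule']] /setP ff.
have aE x y : adj (rel_of E) x y = adj (rel_of E') x y.
  have aE' a b : a \in i.1 -> adj (rel_of E) a b = adj (rel_of E') a b.
    move=> aX; have [bX|bX] := boolP (b \in i.1).
      by apply/idP/idP => [/bip|/bip']; rewrite aX bX.
    by have := ff (a, b); rewrite !inE/= aX bX.
  have [xX|xX] := boolP (x \in i.1); first exact: aE'.
  have [yX|yX] := boolP (y \in i.1); first by rewrite adjC aE'// adjC.
  by apply/idP/idP => [/bip|/bip']; rewrite (negbTE xX) (negbTE yX).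
have rE x y : x \in i.1 -> adj (rel_of E) x y -> rel_of E x y = rel_of E' x y.
  move=> xX xy; rewrite rule// rule' -?aE//.
  by under eq_existsb do rewrite aE; under [X in _ && X]eq_existsb do rewrite aE.
apply/setP => -[x y]; change (rel_of E x y = rel_of E' x y).
have [xy|xy] := boolP (adj (rel_of E) x y); last first.
  have := xy; rewrite aE; move: xy; rewrite /adj !negb_or.
  by move=> /andP[/negbTE-> _] /andP[/negbTE->].
have [xX|xX] := boolP (x \in i.1); first exact: rE.
have yX : y \in i.1 by have := bip _ _ xy; rewrite (negbTE xX); case: (y \in _).
have yx : adj (rel_of E) y x by rewrite adjC.
by rewrite (adj_rev hE yx) (adj_rev hE') -?aE// rE.
Qed.

Definition layer_edges A B := setX A B :|: setX B (~: (A :|: B)).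

Lemma layered_sub E A B : layered (rel_of E) A B -> E \subset layer_edges A B.
Proof.
case/andP => dAB /forallP h; apply/subsetP => -[x y] xy.
by have /forallP/(_ y)/implyP/(_ xy) := h x; rewrite !inE.
Qed.

Lemma layeredE E A B : [disjoint A & B] ->
  layered (rel_of E) A B = (E \subset layer_edges A B).
Proof.
move=> dAB; apply/idP/idP => [|/subsetP h]; first exact: layered_sub.
rewrite /layered dAB/=; apply/forallP => x; apply/forallP => y; apply/implyP => xy.
by have := h _ xy; rewrite !inE.
Qed.

Lemma card_layer_edges A B : [disjoint A & B] -> #|layer_edges A B| = (#|B| * #|~: B|)%N.
Proof.
move=> dAB; rewrite cardsU !cardsX.
have -> : setX A B :&: setX B (~: (A :|: B)) = set0.
  apply/setP => -[x y]; rewrite !inE/=; apply/negP => /andP[/andP[xA _] /andP[xB _]].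
  by have := disjointFr dAB xA; rewrite xB.
rewrite cards0 subn0 mulnC -mulnDr; congr (_ * _)%N.
rewrite -(cardsID A (~: B)); congr (_ + _)%N.
  congr #|pred_of_set _|; apply/esym/setIidPr; apply/subsetP => x xA.
  by rewrite inE (disjointFr dAB xA).
by congr #|pred_of_set _|; apply/setP => x; rewrite !inE negb_or.
Qed.

Definition layerings A B : {set {set T * T}} := [set E | layered (rel_of E) A B].

Lemma card_layerings_le A B : (#|layerings A B| <= 2 ^ (#|B| * #|~: B|))%N.
Proof.
have [dAB|dAB] := boolP [disjoint A & B].
  rewrite -(card_layer_edges dAB) -card_powerset subset_leq_card//.
  by apply/subsetP => E; rewrite inE powersetE; exact: layered_sub.
rewrite (_ : layerings A B = set0) ?cards0//; apply/setP => E; rewrite !inE.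
by rewrite /layered (negbTE dAB).
Qed.

Lemma card_layerings_ler A B : #|layerings A B|%:R <= 2 `^ (n ^+ 2 / 4) :> R.
Proof.
by apply: le_trans (exp2_mul_cardC_le B); rewrite ler_nat card_layerings_le.
Qed.

(** For a fixed middle layer [B] the bound on the edge sets does not depend on [A], which ranges
    over subsets of the complement; [#|~: B| * (#|B| + 1)] is at most [(n + 1) ^ 2 / 4]. *)
Lemma card_layered : #|[set E : {set T * T} | [exists A : {set T}, exists B : {set T}, layered (rel_of E) A B]]|%:R <=
  2 `^ (n ^+ 2 / 4 + 3 / 2 * n + 1 / 4) :> R.
Proof.
pose F B := [set E : {set T * T} | [exists A : {set T}, layered (rel_of E) A B]].
have -> : n ^+ 2 / 4 + 3 / 2 * n + 1 / 4 = n + (n + 1) ^+ 2 / 4 by field.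
rewrite powRD ?pnatr_eq0 ?implybT// -natr_exp2 -card_powersetT.
apply: (card_cover_le (F := F)) => [E|B _].
  rewrite inE => /existsP[A /existsP[B h]]; exists B; rewrite ?in_setT// inE.
  by apply/existsP; exists A.
apply: (@le_trans _ _ (2 `^ (#|~: B|%:R * (#|B|%:R + 1)))); last first.
  rewrite ler_powR ?ler1n// -(cardsC B) natrD -subr_ge0.
  set b : R := #|B|%:R; set c : R := #|~: B|%:R.
  rewrite (_ : _ - _ = ((b + 1 - c) / 2) ^+ 2) ?sqr_ge0//; by field.
rewrite mulrDr mulr1 addrC powRD ?pnatr_eq0 ?implybT// -natr_exp2 -card_powerset.
apply: (card_cover_le (F := layerings^~ B)) => [E|A _].
  rewrite inE => /existsP[A h]; exists A; last by rewrite inE.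
  by rewrite powersetE subsets_disjoint setCK; case/andP: h.
by rewrite -natrM -natr_exp2 ler_nat mulnC card_layerings_le.
Qed.

(** Two layers determine the third, so it is enough to record the small layer and one arbitrary
    other. *)
Lemma card_small_layer (theta M : R) : #|small T theta|%:R <= M ->
  #|[set E : {set T * T} | `[< exists A B : {set T}, layered (rel_of E) A B /\
    [\/ density R A <= theta, density R B <= theta | density R (~: (A :|: B)) <= theta] >]]|%:R
  <= 3 * (2 `^ n * M * 2 `^ (n ^+ 2 / 4)).
Proof.
move=> sM.
pose J : {set 'I_3 * ({set T} * {set T})} := setX setT (setX setT (small T theta)).
have JE : #|J|%:R <= 3 * (2 `^ n * M).
  rewrite !cardsX !cardsT card_ord card_set_of !natrM natr_exp2.
  by rewrite ler_wpM2l// ler_wpM2l// powR_ge0.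
rewrite mulrA (le_trans _ (ler_wpM2r (powR_ge0 _ _) JE))//.
pose F (i : 'I_3 * ({set T} * {set T})) := if i.1 == 0%N :> nat then layerings i.2.2 i.2.1
  else if i.1 == 1%N :> nat then layerings i.2.1 i.2.2
  else layerings (~: (i.2.1 :|: i.2.2)) i.2.1.
apply: (card_cover_le (F := F)) => [E|i _]; last first.
  by rewrite /F; case: ifP => _; [|case: ifP => _]; exact: card_layerings_ler.
rewrite inE => /asboolP[A [B [lay [h|h|h]]]].
- by exists (inord 0, (B, A)); rewrite ?in_setX ?in_setT ?inE// /F/= inordK// inE.
- by exists (inord 1, (A, B)); rewrite ?in_setX ?in_setT ?inE// /F/= inordK// inE.
exists (inord 2, (B, ~: (A :|: B))); first by rewrite ?in_setX ?in_setT inE.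
rewrite /F/= inordK//= inE.
suff -> : ~: (B :|: ~: (A :|: B)) = A by [].
case/andP: lay => dAB _; apply/setP => x; rewrite !inE ?negb_or ?negbK.
by have [xA|] := boolP (x \in A); [rewrite (disjointFr dAB xA)|case: (x \in B)].
Qed.

(** Two layers and two witnesses take [4 * n] bits; an empty block of at least [r ^ 2] admissible
    pairs saves as many. *)
Lemma card_not_dense (r : nat) :
  #|[set E : {set T * T} | `[< exists A B : {set T}, layered (rel_of E) A B /\
    (~ dense (rel_of E) r A B \/ ~ dense (rel_of E) r B (~: (A :|: B))) >]]|%:R
  <= 2 `^ (n ^+ 2 / 4 + 4 * n - r%:R ^+ 2) :> R.
Proof.
pose F (i : ({set T} * {set T}) * ({set T} * {set T})) :=
  [set E in layerings i.1.1 i.1.2 |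
    [&& setX i.2.1 i.2.2 \subset layer_edges i.1.1 i.1.2, (r <= #|i.2.1|)%N, (r <= #|i.2.2|)%N
      & E :&: setX i.2.1 i.2.2 == set0]].
have -> : n ^+ 2 / 4 + 4 * n - r%:R ^+ 2 = 4 * n + (n ^+ 2 / 4 - r%:R ^+ 2) by ring.
rewrite powRD ?pnatr_eq0 ?implybT//.
have -> : 2 `^ (4 * n) = #|[set: (({set T} * {set T}) * ({set T} * {set T}))%type]|%:R.
  rewrite cardsT !card_prod card_set_of -!expnD natr_exp2 !natrD; congr (_ `^ _); ring.
apply: (card_cover_le (F := F)) => [E|[[A B] [S1 S2]] _].
  rewrite inE => /asboolP[A [B [lay nd]]].
  have [S1 [S2 [sub r1 r2 no]]] : exists S1 S2, [/\ setX S1 S2 \subset layer_edges A B,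
      (r <= #|S1|)%N, (r <= #|S2|)%N & ~ exists x y, [/\ x \in S1, y \in S2 & rel_of E x y]].
    have nd2 (A' B' : {set T}) : ~ dense (rel_of E) r A' B' -> setX A' B' \subset layer_edges A B ->
        exists S1 S2, [/\ setX S1 S2 \subset layer_edges A B,
      (r <= #|S1|)%N, (r <= #|S2|)%N & ~ exists x y, [/\ x \in S1, y \in S2 & rel_of E x y]].
      move=> /existsNP[S1 /existsNP[S2]].
      move=> /not_implyP[s1 /not_implyP[s2 /not_implyP[r1 /not_implyP[r2 no]]]] sub.
      by exists S1, S2; split => //; apply: subset_trans sub; exact: setXS.
    by case: nd => /nd2; apply; [exact: subsetUl|exact: subsetUr].
  exists ((A, B), (S1, S2)); rewrite ?in_setT// inE/= inE lay sub r1 r2/=.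
  apply/eqP/setP => -[x y]; rewrite !inE; apply/negP => /and3P[xy xS yS].
  by apply: no; exists x, y.
have [->|/set0Pn[E0]] := eqVneq (F ((A, B), (S1, S2))) set0.
  by rewrite cards0 powR_ge0.
rewrite inE inE/= => /andP[/andP[dAB _] /and4P[sub r1 r2 _]].
apply: (@le_trans _ _ (2 ^ #|layer_edges A B :\: setX S1 S2|)%:R).
  rewrite -card_powerset ler_nat subset_leq_card//; apply/subsetP => E.
  rewrite inE inE/= powersetE subsetD => /andP[/layered_sub -> /and4P[_ _ _]].
  by rewrite setI_eq0.
rewrite natr_exp2 ler_powR ?ler1n// cardsD (setIidPr sub) natrB ?subset_leq_card//.
rewrite card_layer_edges// lerB ?mul_cardC_le// cardsX natrM expr2.
by rewrite ler_pM// ler_nat.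
Qed.

End LayeredCounts.

(** * The Kleitman-Rothschild recursion *)

Section Asymptotics.
Variable R : realType.

Lemma exp2D (x y : R) : 2 `^ (x + y) = 2 `^ x * 2 `^ y.
Proof. by rewrite powRD// pnatr_eq0 implybT. Qed.

Lemma exp2_gt0 (x : R) : 0 < 2 `^ x.
Proof. by rewrite powR_gt0. Qed.

Lemma exp2_le (x y : R) : x <= y -> 2 `^ x <= 2 `^ y.
Proof. by move=> xy; rewrite ler_powR// ler1n. Qed.

(** Raising [b n <= expR (b n)] to the power [k.+1] leaves a spare factor [n] to absorb the
    constant. *)
Lemma poly_le_exp2 (c C : R) (k : nat) : 0 < c -> 0 <= C ->
  exists n0 : nat, forall n : nat, (n0 <= n)%N -> C * n.+1%:R ^+ k <= 2 `^ (c * n%:R).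
Proof.
move=> c0 C0; pose a := c * ln 2.
have a0 : 0 < a by rewrite mulr_gt0// ln_gt0// ltr1n.
pose b := a / k.+1%:R; have b0 : 0 < b by rewrite divr_gt0.
exists (Num.truncn (C * 2 ^+ k / b ^+ k.+1)).+1 => n nn.
have n0 : 0 < n%:R :> R by rewrite ltr0n; case: n nn.
have h : C * 2 ^+ k <= b ^+ k.+1 * n%:R.
  rewrite [leRHS]mulrC -ler_pdivrMr ?exprn_gt0//.
  by apply: (le_trans (ltW (truncnS_gt _))); rewrite ler_nat.
apply: (@le_trans _ _ ((b * n%:R) ^+ k.+1)).
  apply: (@le_trans _ _ (C * (2 * n%:R) ^+ k)).
    rewrite ler_wpM2l// lerXn2r ?nnegrE ?mulr_ge0// mulr_natl mulr2n -natr1 lerD2l.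
    by rewrite ler1n -(ltr0n R).
  by rewrite (exprMn _ 2) (exprMn _ b) mulrA (exprSr n%:R) [leRHS]mulrA [leRHS]mulrAC ler_wpM2r ?exprn_ge0//.
rewrite /powR pnatr_eq0/=.
have -> : c * n%:R * ln 2 = (b * n%:R) * k.+1%:R by rewrite /b [RHS]mulrAC divfK ?pnatr_eq0// /a; ring.
rewrite expRM_natr lerXn2r ?nnegrE ?expR_ge0 ?(mulr_ge0 (ltW b0) (ler0n _ _))//.
by apply: le_trans (expR_ge1Dx _); rewrite lerDr.
Qed.

Definition kr_main (n : nat) : R := 2 `^ (n%:R ^+ 2 / 4 + 3 / 2 * n%:R).

Lemma kr_mainE n : kr_main n = 2 `^ (n%:R ^+ 2 / 4 + 3 / 2 * n%:R).
Proof. by []. Qed.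

Lemma kr_main_gt0 n : 0 < kr_main n.
Proof. exact: exp2_gt0. Qed.

Lemma kr_main_ge1 n : 1 <= kr_main n.
Proof.
rewrite -(powRr0 (2 : R)) exp2_le// addr_ge0 ?mulr_ge0 ?divr_ge0//.
Qed.

Lemma kr_mainS n : kr_main n * 2 `^ (n.+1%:R / 2) <= kr_main n.+1.
Proof.
rewrite /kr_main -exp2D exp2_le// -(natr1 n); move: (n%:R : R) => x.
lra.
Qed.

Lemma smallS (T : finType) (s t M : R) : s <= t ->
  #|small T t|%:R <= M -> #|small T s|%:R <= M.
Proof.
move=> st; apply: le_trans; rewrite ler_nat subset_leq_card//.
by apply/subsetP => A; rewrite !inE => /le_trans; apply.
Qed.

Definition unlayered (T : finType) : {set {set T * T}} :=
  [set E in hasse_set T | ~~ [exists A : {set T}, exists B : {set T}, layered (rel_of E) A B]].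

Lemma cardsU_ler (X : finType) (A B : {set X}) (a b : R) :
  #|A|%:R <= a -> #|B|%:R <= b -> #|A :|: B|%:R <= a + b.
Proof.
move=> Aa Bb; apply: (le_trans _ (lerD Aa Bb)).
by rewrite -natrD ler_nat cardsU leq_subr.
Qed.

(** The constants are fixed in the order [rho], [d0], [k1], [d4], [ge], [d], [er], [q], each slack
    after its gap. The smallest gap is [d], so [c = d / 2] is saved in every reducible case. *)
Lemma unlayered_recursion : exists (c C : R) (k n0 : nat), [/\ 0 < c, 0 <= C &
  forall n, (n0 <= n)%N -> #|unlayered 'I_n.+1|%:R <=
    C * n.+2%:R ^+ k * (#|hasse_set 'I_n|%:R * 2 `^ ((1 / 2 - c) * n.+1%:R)) +
    4 * kr_main n.+1 * 2 `^ (- (1 / 4) * n.+1%:R)].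
Proof.
have half (x : R) : 0 < x -> 0 < x / 2 by move=> ?; rewrite divr_gt0.
have e8 : 0 < 1 / 8 :> R by rewrite divr_gt0.
(* [X] takes [n] bits and the two minorities [n / 8] each, which is [n / 4] below the [3 n / 2] of
   [kr_main]. *)
have [rho /andP[rho0 rho1] hrho] := small_bound e8.
have [d0 /andP[d00 d01] hd0] := small_bound e8.
have d02 := half _ d00; have d04 := half _ d02.
have [k1' /andP[k10' _] hk1'] := small_bound d04.
pose k1 := Num.min k1' d0.
have k10 : 0 < k1 by rewrite lt_min k10'.
have k1k : k1 <= k1' by rewrite ge_min lexx.
have k1d : k1 <= d0 by rewrite ge_min lexx orbT.
clearbody k1.
pose d4 := k1 * rho ^+ 2 / 2.
have rho2 : 0 < rho ^+ 2 by rewrite exprn_gt0.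
have rho21 : rho ^+ 2 <= 1 by rewrite expr_le1// ltW.
have d40 : 0 < d4 by rewrite half// mulr_gt0.
have d4r : d4 <= k1 * rho ^+ 2 by rewrite /d4 ler_pdivrMr// mulr_natr mulr2n lerDl mulr_ge0// ltW.
have d4k : 2 * d4 <= k1.
  by rewrite /d4 mulrC divfK ?pnatr_eq0// -[leRHS]mulr1 ler_wpM2l// ltW.
clearbody d4.
have d42 := half _ d40; have d44 := half _ d42.
have [z /andP[z0 _] hz] := small_bound d44.
(* The hitting property requires [43 * ge + d4 / 2 <= d4]; 200 is a comfortable divisor. *)
pose ge := d4 / 200.
have ge0 : 0 < ge by rewrite divr_gt0.
have ge2 := half _ ge0.
have [w /andP[w0 _] hw] := small_bound ge2.
pose d := Num.min (w / 2) ge.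
have d00' : 0 < d by rewrite lt_min half.
have dw : 2 * d <= w by rewrite mulrC -ler_pdivlMr// ge_min lexx.
have dge : d <= ge by rewrite ge_min lexx orbT.
clearbody d.
have d2 := half _ d00'.
have [er' /andP[er0' _] her'] := small_bound d2.
pose er := Num.min er' (d0 / 2).
have er0 : 0 < er by rewrite lt_min er0'.
have ere : er <= er' by rewrite ge_min lexx.
have erd : er <= d0 / 2 by rewrite ge_min lexx orbT.
clearbody er.
pose q := (Num.truncn er^-1).+1.
have erq : er^-1 <= q%:R by rewrite ltW// truncnS_gt.
pose k := (3 * q + 2)%N.
pose c := d / 2.
have c1 : c <= 1 / 4 by rewrite /c; move: dge d4k k1d d01; rewrite /ge; clear; lra.
(* Five classes share this bound: low degree and the four failures of irreducibility. *)
pose C : R := 5 * (2 ^ (4 ^ k) * 2 ^ k)%:R.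
exists c, C, k.+1, (Num.truncn (q.+2%:R / (d0 / 2))).
split; [exact: d2|by rewrite mulr_ge0|move=> n nn].
have big : q.+2%:R / #|'I_n.+1|%:R + er < d0.
  rewrite card_ord; suff : q.+2%:R / n.+1%:R < d0 / 2 :> R by move: erd; move: (q.+2%:R / n.+1%:R) => y; clear; lra.
  rewrite ltr_pdivrMr ?ltr0n// mulrC -ltr_pdivrMr//.
  by apply: (lt_le_trans (truncnS_gt _)); rewrite ler_nat ltnS.
have hM g e' : #|small 'I_n.+1 e'|%:R <= 2 `^ (g / 2 * #|'I_n.+1|%:R) -> c <= g / 2 ->
   #|[set E in hasse_set 'I_n.+1 | ~~ `[< irreducible (rel_of E) k g e' >]]|%:R <=
   (n.+2%:R ^+ k.+1 * (2 ^ (4 ^ k) * 2 ^ k)%:R) *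
   (#|hasse_set 'I_n|%:R * 2 `^ ((1 / 2 - c) * n.+1%:R)).
  move=> h cg; apply: le_trans (card_reducible k g h) _; apply: ler_pM => //.
  - by rewrite mulnA natrM ler_wpM2r// natrM natrX exprS ler_wpM2r ?exprn_ge0// ler_nat.
  rewrite ler_wpM2l// card_ord -exp2D exp2_le// -mulrDl ler_wpM2r//; lra.
have M0 : #|[set E in hasse_set 'I_n.+1 | [exists v, density R (nbr (rel_of E) v) <= d0]]|%:R <=
   (n.+2%:R ^+ k.+1 * (2 ^ (4 ^ k) * 2 ^ k)%:R) *
   (#|hasse_set 'I_n|%:R * 2 `^ ((1 / 2 - c) * n.+1%:R)).
  apply: le_trans (card_low_degree (hd0 'I_n.+1)) _; apply: ler_pM => //.
  - rewrite -natrX -natrM ler_nat expnS -mulnA (leq_trans (leqnSn _))// leq_pmulr//.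
    by rewrite !muln_gt0 !expn_gt0.
  rewrite ler_wpM2l// card_ord -exp2D exp2_le// -mulrDl ler_wpM2r//; lra.
have cov : unlayered 'I_n.+1 \subset
  [set E in hasse_set 'I_n.+1 | [exists v, density R (nbr (rel_of E) v) <= d0]] :|:
  [set E in hasse_set 'I_n.+1 | ~~ `[< irreducible (rel_of E) k d er >]] :|:
  [set E in hasse_set 'I_n.+1 | ~~ `[< irreducible (rel_of E) k ge (2 * d) >]] :|:
  [set E in hasse_set 'I_n.+1 | ~~ `[< irreducible (rel_of E) k (d0 / 2) k1 >]] :|:
  [set E in hasse_set 'I_n.+1 | ~~ `[< irreducible (rel_of E) k (d4 / 2) 0 >]] :|:
  [set E in hasse_set 'I_n.+1 | `[< exists X U, two_layered (rel_of E) rho X U >]].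
  apply/subsetP => E; rewrite inE => /andP[hE nl].
  rewrite !in_setU.
  have irr g e' : E \notin [set E in hasse_set 'I_n.+1 | ~~ `[< irreducible (rel_of E) k g e' >]] ->
      irreducible (rel_of E) k g e'.
    by rewrite inE hE/= negbK => /asboolP.
  case: (boolP (E \in [set _ in _ | [exists v, _]])) => //=; rewrite inE hE/= => /existsPn deg.
  case: (boolP (E \in [set _ in _ | ~~ `[< irreducible _ k d er >]])) => //= /irr i1.
  case: (boolP (E \in [set _ in _ | ~~ `[< irreducible _ k ge (2 * d) >]])) => //= /irr i2.
  case: (boolP (E \in [set _ in _ | ~~ `[< irreducible _ k (d0 / 2) k1 >]])) => //= /irr i3.
  case: (boolP (E \in [set _ in _ | ~~ `[< irreducible _ k (d4 / 2) 0 >]])) => //= /irr i4.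
  rewrite inE hE.
  apply/asboolP; have /hasse_setP he := hE.
  have n1 : (0 < #|'I_n.+1|)%N by rewrite card_ord.
  have mindeg v : d0 < density R (nbr (rel_of E) v) by rewrite ltNge deg.
  have h1 : 0 <= d <= ge by rewrite (ltW d00').
  have h2 : 200 * ge <= d4 by rewrite /ge mulrC divfK ?pnatr_eq0.
  have h3 : k1 <= d0 <= 1 by rewrite k1d.
  have [[A [B lay]]|//] := irreducible_dichotomy he n1 (leqnn _) mindeg er0 erq big
    i1 i2 i3 i4 h1 h2 d40 d4k h3 d4r rho0.
  by case/negP: nl; apply/existsP; exists A; apply/existsP; exists B.
have {}cov := subset_leq_card cov; rewrite -(ler_nat R) in cov; apply: le_trans cov _.
have T2 : #|[set E in hasse_set 'I_n.+1 | `[< exists X U, two_layered (rel_of E) rho X U >]]|%:R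
    <= 4 * kr_main n.+1 * 2 `^ (- (1 / 4) * n.+1%:R).
  apply: le_trans (card_two_layered (hrho 'I_n.+1)) _.
  rewrite card_ord expr2 -mulrA -[leRHS]mulrA /kr_main -exp2D.
  have -> : 2 * 2 `^ (1 / 8 * n.+1%:R) * (2 * 2 `^ (1 / 8 * n.+1%:R) * 2 `^ (n.+1%:R ^+ 2 / 4)) =
    4 * (2 `^ (1 / 8 * n.+1%:R) * (2 `^ (1 / 8 * n.+1%:R) * 2 `^ (n.+1%:R ^+ 2 / 4))) :> R by ring.
  rewrite mulrCA ler_wpM2l// -!exp2D exp2_le//; lra.
apply: le_trans (cardsU_ler (cardsU_ler (cardsU_ler (cardsU_ler (cardsU_ler M0
  (hM _ _ _ _)) (hM _ _ _ _)) (hM _ _ _ _)) (hM _ _ _ _)) T2) _.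
- exact: smallS ere (her' _).
- by [].
- exact: smallS dw (hw _).
- by rewrite /c ler_wpM2r.
- exact: smallS k1k (hk1' _).
- by rewrite /c; move: dge d4k k1d d00; rewrite /ge; clear; lra.
- exact: smallS (ltW z0) (hz _).
- by rewrite /c; move: dge d40; rewrite /ge; clear; lra.
rewrite lerD2r /C; set X := _ * _%:R; set Y := _ * 2 `^ _.
rewrite le_eqVlt; apply/orP; left; apply/eqP.
by rewrite /X /Y; ring.
Qed.

End Asymptotics.

(** * Solving the recursion *)

Section UpperBounds.
Variable R : realType.
Local Notation kr_main := (kr_main R).

Lemma card_hasse_split n : #|hasse_set 'I_n|%:R <= 2 * kr_main n + #|unlayered 'I_n|%:R.
Proof.
pose L := [set E : {set 'I_n * 'I_n} | [exists A : {set 'I_n}, exists B : {set 'I_n},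
  layered (rel_of E) A B]].
have : hasse_set 'I_n \subset L :|: unlayered 'I_n.
  apply/subsetP => E hE; rewrite !inE in hE *; rewrite hE/=.
  by case: [exists A, _].
move/subset_leq_card; rewrite -(ler_nat R) => /le_trans; apply.
apply: cardsU_ler => //; apply: le_trans (card_layered R 'I_n) _.
rewrite card_ord exp2D mulrC ler_wpM2r ?(ltW (exp2_gt0 _))//.
by rewrite -[leRHS]powRr1// exp2_le//; lra.
Qed.

Lemma hasse_growth : exists2 M : R, 0 <= M & forall n, #|hasse_set 'I_n|%:R <= M * kr_main n.
Proof.
have [c [C [k [n0 [c0 C0 rec]]]]] := unlayered_recursion R.
have C4 : 0 <= 4 * C by rewrite mulr_ge0.
have [n1 hn1] := poly_le_exp2 k c0 C4.
have q0 : 0 < 1 / 4 :> R by rewrite divr_gt0.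
have [n2 hn2] := @poly_le_exp2 R _ 4 0 q0 (ler0n _ _).
pose N := maxn n0 (maxn n1 n2).
(* The sum settles the indices up to [N]. Beyond, the induction yields [2 + M / 4 + 1], at most [M]
   because [M >= 4]. *)
pose M : R := 4 + \sum_(m < N.+1) #|hasse_set 'I_m|%:R.
have M4 : 4 <= M by rewrite lerDl sumr_ge0.
have M0 : 0 <= M by apply: le_trans M4.
exists M => //; elim=> [|n IH].
  rewrite (le_trans _ (ler_wpM2l M0 (kr_main_ge1 R 0)))// mulr1.
  by rewrite /M big_ord_recl addrCA lerDl addr_ge0// sumr_ge0.
have [nN|Nn] := ltnP n N.
  rewrite (le_trans _ (ler_wpM2l M0 (kr_main_ge1 R _)))// mulr1.
  rewrite /M (bigD1 (inord n.+1))//= inordK ?ltnS// addrCA lerDl addr_ge0// sumr_ge0//.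
rewrite (le_trans (card_hasse_split _))//.
move: Nn; rewrite !geq_max => /and3P[n0n n1n n2n].
have U0 := kr_main_gt0 R n.+1.
have r1 := rec _ n0n.
have h2 : 4 * 2 `^ (- (1 / 4) * n.+1%:R) <= 1 :> R.
  have := hn2 _ (leqW n2n); rewrite expr0 mulr1 mulNr powRN => h.
  by rewrite ler_pdivrMr ?exp2_gt0// [leRHS]mul1r.
have h1 : C * n.+2%:R ^+ k * 2 `^ (- c * n.+1%:R) <= 1 / 4.
  have := hn1 _ (leqW n1n); rewrite mulNr powRN => h.
  rewrite ler_pdivrMr ?exp2_gt0//; move: h; rewrite -mulrA.
  by move: (C * _) (2 `^ _) => x y; clear; lra.
have h3 : #|hasse_set 'I_n|%:R * 2 `^ (1 / 2 * n.+1%:R) <= M * kr_main n.+1 :> R.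
  apply: le_trans (ler_wpM2l M0 (kr_mainS R n)); rewrite mulrA.
  rewrite (_ : 1 / 2 * n.+1%:R = n.+1%:R / 2); last by rewrite mulrAC mul1r.
  by rewrite ler_wpM2r.
have h4 : C * n.+2%:R ^+ k * (#|hasse_set 'I_n|%:R * 2 `^ ((1 / 2 - c) * n.+1%:R)) <=
    1 / 4 * (M * kr_main n.+1).
  rewrite mulrBl exp2D -mulNr (_ : _ * _ = (C * n.+2%:R ^+ k * 2 `^ (- c * n.+1%:R)) *
     (#|hasse_set 'I_n|%:R * 2 `^ (1 / 2 * n.+1%:R))); last by ring.
  by apply: ler_pM => //; rewrite !mulr_ge0// exprn_ge0.
have h5 : 4 * kr_main n.+1 * 2 `^ (- (1 / 4) * n.+1%:R) <= kr_main n.+1.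
  by rewrite mulrAC -[leRHS]mul1r ler_wpM2r// ltW.
have h6 : 4 * kr_main n.+1 <= M * kr_main n.+1 by rewrite ler_wpM2r// ltW.
move: r1 h4 h5 h6; move: (_ * (#|hasse_set _|%:R * _)) (M * _) (_ * _ * 2 `^ _) => x y z.
by clear; lra.
Qed.

(** The growth bound is put back into the recursion; half of the exponential saving absorbs the
    polynomial factor. *)
Lemma unlayered_bound : exists (c : R) (n0 : nat), 0 < c /\
  forall n, (n0 <= n)%N -> #|unlayered 'I_n|%:R <= kr_main n * 2 `^ (- c * n%:R).
Proof.
have [c [C [k [n0 [c0 C0 rec]]]]] := unlayered_recursion R.
have [M M0 grow] := hasse_growth.
pose c1 := Num.min c (1 / 4); have c10 : 0 < c1 by rewrite lt_min c0 divr_gt0.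
have c1c : c1 <= c by rewrite ge_min lexx.
have c14 : c1 <= 1 / 4 by rewrite ge_min lexx orbT.
clearbody c1.
have c2 : 0 < c1 / 2 by rewrite divr_gt0.
have D0 : 0 <= C * M + 4 by rewrite addr_ge0// mulr_ge0.
have [n1 hn1] := poly_le_exp2 k c2 D0.
exists (c1 / 2), (maxn n0 n1).+1; split => // -[//|n].
rewrite ltnS geq_max => /andP[n0n n1n].
apply: le_trans (rec _ n0n) _.
have U0 := kr_main_gt0 R n.+1.
have h3 : #|hasse_set 'I_n|%:R * 2 `^ (1 / 2 * n.+1%:R) <= M * kr_main n.+1 :> R.
  apply: le_trans (ler_wpM2l M0 (kr_mainS R n)); rewrite mulrA.
  rewrite (_ : 1 / 2 * n.+1%:R = n.+1%:R / 2); last by rewrite mulrAC mul1r.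
  by rewrite ler_wpM2r.
set e1 : R := 2 `^ (- c1 * n.+1%:R).
have e10 : 0 < e1 by exact: exp2_gt0.
have h4 : C * n.+2%:R ^+ k * (#|hasse_set 'I_n|%:R * 2 `^ ((1 / 2 - c) * n.+1%:R)) <=
    (C * M * n.+2%:R ^+ k) * (kr_main n.+1 * e1).
  have h : 2 `^ ((1 / 2 - c) * n.+1%:R) <= 2 `^ (1 / 2 * n.+1%:R) * e1 :> R.
    by rewrite -exp2D exp2_le// -mulrDl ler_wpM2r// lerD2l lerN2.
  apply: (@le_trans _ _ (C * n.+2%:R ^+ k * (M * kr_main n.+1 * e1))).
    rewrite ler_wpM2l ?mulr_ge0 ?exprn_ge0//.
    apply: (le_trans (ler_wpM2l (ler0n _ _) h)).
    by rewrite mulrA ler_wpM2r// ltW.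
  by rewrite le_eqVlt; apply/orP; left; apply/eqP; ring.
have h5 : 4 * kr_main n.+1 * 2 `^ (- (1 / 4) * n.+1%:R) <= 4 * (kr_main n.+1 * e1).
  rewrite mulrA; apply: ler_wpM2l; first by rewrite mulr_ge0 ?(ltW U0).
  by apply: exp2_le; rewrite ler_wpM2r// lerN2.
apply: (le_trans (lerD h4 h5)).
have -> : 2 `^ (- (c1 / 2) * n.+1%:R) = 2 `^ (c1 / 2 * n.+1%:R) * e1.
  by rewrite -exp2D; congr (_ `^ _); field.
rewrite -mulrDl [leRHS]mulrCA ler_wpM2r// ?mulr_ge0 ?(ltW U0) ?(ltW e10)//.
apply: le_trans (hn1 n.+1 (leqW n1n)).
by rewrite [leRHS]mulrDl lerD2l ler_peMr// exprn_ege1// ler1n.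
Qed.

Definition not_nice n (theta : R) (r : nat) : {set {set 'I_n * 'I_n}} :=
  [set E in hasse_set 'I_n | ~~ `[< exists A B, layered (rel_of E) A B /\
    nice (rel_of E) theta r A B >]].

Lemma not_nice_bound : exists (c theta : R) (n0 : nat), [/\ 0 < c, 0 < theta &
  forall n r, (n0 <= n)%N -> 5 * n%:R <= r%:R ^+ 2 :> R ->
    #|not_nice n theta r|%:R <= 5 * kr_main n * 2 `^ (- c * n%:R)].
Proof.
have [c [n0 [c0 hn0]]] := unlayered_bound.
have q0 : 0 < 1 / 4 :> R by rewrite divr_gt0.
have [theta /andP[th0 th1] hth] := small_bound q0.
pose c1 := Num.min c (1 / 4); have c10 : 0 < c1 by rewrite lt_min c0 divr_gt0.
have c1c : c1 <= c by rewrite ge_min lexx.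
have c14 : c1 <= 1 / 4 by rewrite ge_min lexx orbT.
exists c1, theta, n0; split => // n r nn hr.
have sub : not_nice n theta r \subset unlayered 'I_n :|:
  [set E : {set 'I_n * 'I_n} | `[< exists A B : {set 'I_n}, layered (rel_of E) A B /\
    [\/ density R A <= theta, density R B <= theta | density R (~: (A :|: B)) <= theta] >]] :|:
  [set E : {set 'I_n * 'I_n} | `[< exists A B : {set 'I_n}, layered (rel_of E) A B /\
    (~ dense (rel_of E) r A B \/ ~ dense (rel_of E) r B (~: (A :|: B))) >]].
  apply/subsetP => E; rewrite inE => /andP[hE /asboolPn nE].
  rewrite !in_setU; case: (boolP (E \in unlayered _)) => //=.
  rewrite inE hE/= negbK => /existsP[A /existsP[B lay]].
  apply/orP; have [d1|d1] := pselect (dense (rel_of E) r A B); last first.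
    by right; rewrite inE; apply/asboolP; exists A, B; split=> //; left.
  have [d2|d2] := pselect (dense (rel_of E) r B (~: (A :|: B))); last first.
    by right; rewrite inE; apply/asboolP; exists A, B; split=> //; right.
  left; rewrite inE; apply/asboolP; exists A, B; split => //.
  apply/or3P; rewrite -[_ || _]negbK; apply/negP; rewrite !negb_or -!ltNge => /and3P[a b d].
  by apply: nE; exists A, B.
have U0 := ltW (kr_main_gt0 R n).
move/subset_leq_card: sub; rewrite -(ler_nat R) => /le_trans; apply.
have -> : 5 * kr_main n * 2 `^ (- c1 * n%:R) = kr_main n * 2 `^ (- c1 * n%:R) +
  3 * (kr_main n * 2 `^ (- c1 * n%:R)) + kr_main n * 2 `^ (- c1 * n%:R) by ring.
apply: cardsU_ler; first apply: cardsU_ler.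
- apply: le_trans (hn0 _ nn) _; apply: ler_wpM2l => //.
  by apply: exp2_le; rewrite ler_wpM2r// lerN2.
- apply: le_trans (card_small_layer (hth 'I_n)) _; rewrite ler_wpM2l//.
  rewrite card_ord kr_mainE -!exp2D exp2_le//.
  have : c1 * n%:R <= 1 / 4 * n%:R by rewrite ler_wpM2r.
  by rewrite mulNr; lra.
apply: le_trans (card_not_dense R _ r) _.
rewrite card_ord kr_mainE -!exp2D exp2_le//.
have : c1 * n%:R <= 1 / 4 * n%:R by rewrite ler_wpM2r.
by rewrite mulNr; move: hr; have : 0 <= n%:R :> R by []; lra.
Qed.

End UpperBounds.

(** * A lower bound on the number of layered digraphs *)

Lemma leq_card_disjoint (I X : finType) (J : {set I}) (A : {set X}) (F : I -> {set X}) (m : nat) :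
  (forall i j x, i \in J -> j \in J -> x \in F i -> x \in F j -> i = j) ->
  (forall i, i \in J -> F i \subset A) -> (forall i, i \in J -> m <= #|F i|)%N ->
  (#|J| * m <= #|A|)%N.
Proof.
move=> dF FA mF; apply: (@leq_trans (\sum_(i in J) #|F i|)%N).
  by rewrite -sum_nat_const; apply: leq_sum.
under eq_bigr do rewrite -sum1_card.
rewrite (exchange_big_dep (mem A))/=; last by move=> i x /FA/subsetP; exact.
rewrite -[leqRHS]sum1_card; apply: leq_sum => x _.
rewrite sum1_card; apply/card_le1_eqP => i j /andP[iJ xi] /andP[jJ xj].
exact: (dF _ _ x).
Qed.

(** Even and odd rows are proved together, since the central entry of an even row is twice one of
    the odd row before it. *)
Lemma central_binomial_even m :
  (2 ^ (2 * m) <= (2 * m).+1 * 'C(2 * m, m))%N /\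
  (2 ^ (2 * m).+1 <= (2 * m).+2 * 'C((2 * m).+1, m))%N.
Proof.
elim: m => [//|m [_ IH]].
have step1 : (2 ^ (2 * m.+1) <= (2 * m.+1).+1 * 'C(2 * m.+1, m.+1))%N.
  have -> : (2 * m.+1 = (2 * m).+2)%N by lia.
  rewrite binS -(@bin_sub (2 * m).+1 m.+1); last by lia.
  have -> : ((2 * m).+1 - m.+1 = m)%N by lia.
  by rewrite expnS; move: IH; nia.
split => //.
have := mul_bin_diag (2 * m.+1).+1 m.+1.
rewrite -[in X in _ = X -> _](@bin_sub (2 * m.+1).+1 m.+2); last by lia.
have -> : ((2 * m.+1).+1 - m.+2 = m.+1)%N by lia.
rewrite [(2 * m.+1).+1.-1]/= => h.
rewrite expnS; move: step1 h.
have -> : ((2 * m.+1).+2 = 2 * m.+2)%N by lia.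
by move=> h1 h2; rewrite -mulnA -h2 leq_mul2l h1.
Qed.

Lemma central_binomial m : (2 ^ m <= m.+1 * 'C(m, m./2))%N.
Proof.
have [h1 h2] := central_binomial_even m./2.
have : (m = 2 * m./2 \/ m = (2 * m./2).+1)%N by lia.
by move: h1 h2; move: (m./2) => k h1 h2 [->|->].
Qed.

Section LayeredLowerBound.
Variable T : finType.
Implicit Types (A B : {set T}) (E : {set T * T}).

(* In these layerings the layers are determined by the graph. *)
Definition full_layerings A B :=
  [set E in layerings A B |
    [forall x in B, (ins (rel_of E) x != set0) && (outs (rel_of E) x != set0)] &&
    [forall x in ~: (A :|: B), ins (rel_of E) x != set0]].

Lemma full_layerings_inj A B A' B' E :
  E \in full_layerings A B -> E \in full_layerings A' B' -> (A, B) = (A', B').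
Proof.
have key A0 B0 : E \in full_layerings A0 B0 ->
    A0 = [set x | ins (rel_of E) x == set0] /\
    B0 = [set x | (ins (rel_of E) x != set0) && (outs (rel_of E) x != set0)].
  rewrite inE => /andP[]; rewrite inE => /andP[dAB /forallP lay] /andP[/forall_inP hB /forall_inP hC].
  have layP x y : rel_of E x y -> (x \in A0) && (y \in B0) || (x \in B0) && (y \notin A0 :|: B0).
    by have /forallP/(_ y)/implyP := lay x.
  have insA x : x \in A0 -> ins (rel_of E) x = set0.
    move=> xA; apply/setP => y; rewrite !inE; apply/negP => /layP.
    by rewrite in_setU xA (disjointFr dAB xA) !andbF.
  have outsC x : x \notin A0 -> x \notin B0 -> outs (rel_of E) x = set0.
    move=> xA xB; apply/setP => y; rewrite !inE; apply/negP => /layP.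
    by rewrite (negbTE xA) (negbTE xB).
  split; apply/setP => x; rewrite [RHS]inE.
    have [xA|xA] := boolP (x \in A0); first by rewrite insA// eqxx.
    have [xB|xB] := boolP (x \in B0).
      by have /andP[/negbTE->] := hB _ xB.
    by apply/esym/negbTE/hC; rewrite !inE negb_or xA.
  have [xB|xB] := boolP (x \in B0); first by rewrite hB.
  have [xA|xA] := boolP (x \in A0); first by rewrite insA// eqxx.
  by rewrite outsC// eqxx andbF.
by move=> /key[-> ->] /key[-> ->].
Qed.

(** A layering that is not full misses all of at least [s] possible edges between one vertex and a
    neighbouring layer. There are at most [3 * #|T|] such events, each of proportion at most
    [2 ^ (- s)], so at most half of the layerings are lost. *)
Lemma card_full_layerings A B (s : nat) : [disjoint A & B] ->
  (s <= #|A|)%N -> (s <= #|B|)%N -> (s <= #|~: (A :|: B)|)%N ->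
  (6 * #|T| <= 2 ^ s)%N -> (2 ^ (#|B| * #|~: B|) <= 2 * #|full_layerings A B|)%N.
Proof.
move=> dAB sA sB sC s6; set C := ~: (A :|: B) in sC *.
set e := (#|B| * #|~: B|)%N.
have eE : #|layer_edges A B| = e by rewrite card_layer_edges.
pose miss (S : {set T * T}) := powerset (layer_edges A B :\: S).
have missP (S : {set T * T}) : S \subset layer_edges A B -> (s <= #|S|)%N -> (#|miss S| <= 2 ^ (e - s))%N.
  by move=> SL sS; rewrite card_powerset cardsD (setIidPr SL) eE leq_exp2l// leq_sub2l.
have in_miss E (S : {set T * T}) : E \in layerings A B -> (forall x y, (x, y) \in S -> ~~ rel_of E x y) -> E \in miss S.
  rewrite inE => /layered_sub EL h; rewrite powersetE subsetD EL/= -setI_eq0.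
  apply/eqP/setP => -[x y]; rewrite !inE; apply/negP => /andP[xy /h].
  by rewrite /rel_of xy.
pose J := [set: 'I_3 * T].
pose F (i : 'I_3 * T) := let x := i.2 in
  if i.1 == 0%N :> nat then (if x \in B then miss (setX A [set x]) else set0)
  else if i.1 == 1%N :> nat then (if x \in B then miss (setX [set x] C) else set0)
  else (if x \in C then miss (setX B [set x]) else set0).
have bad : (#|layerings A B :\: full_layerings A B| <= 3 * #|T| * 2 ^ (e - s))%N.
  rewrite -(ler_nat rat) natrM.
  have -> : (3 * #|T| = #|J|)%N by rewrite cardsT card_prod card_ord.
  apply: (card_cover_le (F := F)) => [E|[i x] _]; last first.
    rewrite ler_nat /F/=; case: ifP => _; [|case: ifP => _].
    - case: ifP => [xB|]; last by rewrite cards0.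
      apply: missP; last by rewrite cardsX cards1 muln1.
      apply: subset_trans (subsetUl _ _); apply: setXS => //.
      by rewrite sub1set.
    - case: ifP => [xB|]; last by rewrite cards0.
      apply: missP; last by rewrite cardsX cards1 mul1n.
      apply: subset_trans (subsetUr _ _); apply: setXS => //.
      by rewrite sub1set.
    - case: ifP => [xC|]; last by rewrite cards0.
      apply: missP; last by rewrite cardsX cards1 muln1.
      apply: subset_trans (subsetUr _ _); apply: setXS => //.
      by rewrite sub1set.
  rewrite in_setD => /andP[nf lay]; move: nf; rewrite inE lay/= negb_and.
  case/orP => [/forall_inPn[x xB]|/forall_inPn[x xC]].
    rewrite negb_and !negbK => /orP[] /eqP/setP h.
      exists (inord 0, x); rewrite ?in_setT// /F/= inordK//= xB; apply: in_miss => // y z.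
      by rewrite in_setX inE => /andP[_ /eqP->]; have := h y; rewrite !inE => ->.
    exists (inord 1, x); rewrite ?in_setT// /F/= inordK//= xB; apply: in_miss => // y z.
    by rewrite in_setX inE => /andP[/eqP-> _]; have := h z; rewrite !inE => ->.
  rewrite negbK => /eqP/setP h.
  exists (inord 2, x); rewrite ?in_setT// /F/= inordK//= xC; apply: in_miss => // y z.
  by rewrite in_setX [z \in _]inE => /andP[_ /eqP->]; have := h y; rewrite !inE => ->.
have layE : #|layerings A B| = (2 ^ e)%N.
  rewrite -eE -card_powerset; apply: eq_card => E; rewrite inE powersetE.
  exact: layeredE.
have se : (s <= e)%N.
  have sC' : (s <= #|~: B|)%N.
    by apply: leq_trans sC _; rewrite subset_leq_card// /C setCU subsetIr.
  by move: sB sC'; rewrite /e; clear; case: s => // s; nia.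
have : (#|layerings A B :\: full_layerings A B| = 2 ^ e - #|full_layerings A B|)%N.
  rewrite cardsD layE (setIidPr _)//; apply/subsetP => E.
  by rewrite inE => /andP[].
move: bad; have -> : (2 ^ e = 2 ^ s * 2 ^ (e - s))%N by rewrite -expnD subnKC.
move: s6; move: (2 ^ s)%N (2 ^ (e - s))%N #|full_layerings A B| #|T| #|_ :\: _|.
by clear => a b f t g; nia.
Qed.

End LayeredLowerBound.

Lemma layered_lower (R : realType) : exists n0 : nat, forall n, (n0 <= n)%N ->
  kr_main R n <= 2 * n.+1%:R ^+ 2 *
    #|[set E : {set 'I_n * 'I_n} | [exists A : {set 'I_n}, exists B : {set 'I_n},
        layered (rel_of E) A B]]|%:R.
Proof.
have q0 : 0 < 1 / 8 :> R by rewrite divr_gt0.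
have [n1 hn1] := @poly_le_exp2 R _ 6 1 q0 (ler0n _ _).
exists (maxn 8 n1) => n; rewrite geq_max => /andP[n8 nn1].
set L := [set E | _].
(* A middle layer of about [n / 2] vertices and outer layers of about [n / 4] nearly maximise the
   count; [s] bounds all three sizes from below. *)
pose h := n./2; pose a := (n - h)./2; pose s := (n %/ 4)%N.
have s6 : (6 * #|'I_n| <= 2 ^ s)%N.
  rewrite card_ord -(ler_nat R) natr_exp2.
  apply: (@le_trans _ _ (2 `^ (1 / 8 * n%:R))); last first.
    apply: exp2_le; rewrite mul1r mulrC ler_pdivrMr// -natrM ler_nat /s; lia.
  apply: le_trans (hn1 _ nn1); rewrite expr1 -natrM ler_nat; lia.
pose J := [set i : {set 'I_n} * {set 'I_n} | [&& #|i.2| == h, i.1 \subset ~: i.2 & #|i.1| == a]].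
have JL : (#|J| * 2 ^ (h * (n - h)).-1 <= #|L|)%N.
  apply: (leq_card_disjoint (F := fun i => full_layerings i.1 i.2)).
  - by move=> [A B] [A' B'] E _ _; exact: full_layerings_inj.
  - move=> [A B] _; apply/subsetP => E; rewrite inE => /andP[]; rewrite inE => lay _.
    by rewrite inE; apply/existsP; exists A; apply/existsP; exists B.
  move=> [A B]; rewrite inE/= => /and3P[/eqP Bh AB /eqP Aa].
  have dAB : [disjoint A & B] by rewrite disjoints_subset.
  have CB : #|~: B| = (n - h)%N by have := cardsC B; rewrite Bh card_ord; clear; lia.
  have Cc : #|~: (A :|: B)| = (n - h - a)%N.
    have := cardsC (A :|: B); rewrite cardsU (disjoint_setI0 dAB) cards0 subn0 Aa Bh card_ord.
    by clear; lia.
  have := card_full_layerings (s := s) dAB; rewrite Aa Bh Cc CB.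
  have sa : (s <= a)%N by rewrite /s /a /h; lia.
  have sh : (s <= h)%N by rewrite /s /h; lia.
  have sc : (s <= n - h - a)%N by rewrite /s /a /h; lia.
  move=> /(_ sa sh sc s6); case: (h * (n - h))%N => [|e]/=; last by rewrite expnS leq_pmul2l.
  by case: #|_|.
have Jge : ('C(n, h) * 'C(n - h, a) <= #|J|)%N.
  rewrite -[X in 'C(X, _)]card_ord -card_draws.
  apply: (leq_card_disjoint (F := fun B : {set 'I_n} => [set i in J | i.2 == B])).
  - by move=> B B' i _ _; rewrite inE => /andP[_ /eqP<-]; rewrite inE => /andP[_ /eqP<-].
  - by move=> B _; apply/subsetP => i; rewrite inE => /andP[].
  move=> B; rewrite inE => /eqP Bh.
  have CB : #|~: B| = (n - h)%N by have := cardsC B; rewrite Bh card_ord; clear; lia.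
  rewrite -CB -cards_draws; apply: (leq_card_in_inj (f := fun A : {set 'I_n} => (A, B))).
    by move=> A A' _ _ [].
  by move=> A; rewrite inE => AB; rewrite !inE/= Bh !eqxx andbT.
have c1 := central_binomial n; have c2 := central_binomial (n - h).
have hn : (h <= n)%N by rewrite /h; lia.
have key : (2 ^ n * 2 ^ (n - h) * 2 ^ (h * (n - h)) <= 2 * n.+1 ^ 2 * #|L|)%N.
  apply: (@leq_trans (2 * (n.+1 ^ 2 * (#|J| * 2 ^ (h * (n - h)).-1)))%N); last first.
    by rewrite -mulnA leq_mul2l/= leq_mul2l JL orbT.
  apply: (@leq_trans (n.+1 ^ 2 * #|J| * 2 ^ (h * (n - h)))); last first.
    have -> : (2 * (n.+1 ^ 2 * (#|J| * 2 ^ (h * (n - h)).-1)) =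
               n.+1 ^ 2 * #|J| * (2 * 2 ^ (h * (n - h)).-1))%N by ring.
    by rewrite leq_mul2l; case: (h * (n - h))%N => [|e]/=; rewrite ?expnS ?leqnn orbT.
  rewrite leq_mul2r; apply/orP; right; apply: (leq_trans (leq_mul c1 c2)).
  by rewrite mulnACA leq_mul// expnS expn1 leq_mul// ltnS leq_subr.
rewrite -(ler_nat R) in key; move: key; rewrite expr2 !natrM !natr_exp2 -!exp2D natrM natrB//.
move=> key; apply: le_trans key; rewrite /kr_main; apply: exp2_le.
have nh : n%:R = 2 * h%:R :> R \/ n%:R = 2 * h%:R + 1 :> R.
  have [hE|hE] : (n = 2 * h \/ n = 2 * h + 1)%N by rewrite /h; clear; lia.
    by left; rewrite {1}hE natrM.
  by right; rewrite {1}hE natrD natrM.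
by case: nh => ->; move: (h%:R : R) => y; lra.
Qed.

(** * Hasse diagrams *)

Section HasseDiagram.
Variable T : finType.
Implicit Types (P E : {set T * T}) (A B : {set T}) (le : rel T).

Definition covers le x y :=
  [&& x != y, le x y & [forall z, le x z && le z y ==> (z == x) || (z == y)]].

Definition hasse P : {set T * T} := [set p | covers (rel_of P) p.1 p.2].

Lemma rel_hasse P x y : rel_of (hasse P) x y = covers (rel_of P) x y.
Proof. by rewrite /rel_of inE. Qed.

Lemma posetsP P : reflect [/\ reflexive (rel_of P), antisymmetric (rel_of P)
  & transitive (rel_of P)] (P \in posets T).
Proof. by rewrite inE; exact: asboolP. Qed.

Lemma hasse_diagram_like P : P \in posets T -> hasse_like (rel_of (hasse P)).
Proof.
move=> /posetsP[r a t]; set le := rel_of P in r a t.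
have cov x y : rel_of (hasse P) x y -> [/\ x != y, le x y &
    forall z, le x z -> le z y -> z = x \/ z = y].
  rewrite rel_hasse => /and3P[xy lxy /forallP h]; split => // z xz zy.
  by have := h z; rewrite -/le xz zy => /orP[/eqP|/eqP]; [left|right].
have anti x y : le x y -> le y x -> x = y by move=> xy yx; apply: a; rewrite xy yx.
split=> [x y z /cov[xy lxy _] /cov[yz lyz _]|x y z w /cov[xy lxy _] /cov[yz lyz _] /cov[zw lzw _]].
  apply/orP => -[|] /cov[xz lxz h].
    by case: (h _ lxy lyz) => h'; move: xy yz; rewrite h' eqxx.
  by move: xz; rewrite (anti _ _ lxz (t _ _ _ lxy lyz)) eqxx.
have lyw := t _ _ _ lyz lzw.
apply/orP => -[|] /cov[xw lxw h].
  case: (h _ lxy lyw) => h'; first by move: xy; rewrite h' eqxx.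
  by move: yz; rewrite (anti _ _ lyz) ?eqxx// h'.
by move: xw; rewrite (anti _ _ lxw (t _ _ _ lxy lyw)) eqxx.
Qed.

(** Induction on the size of the interval: a comparable pair that is not a cover splits at some [z]
    into two smaller intervals. *)
Lemma le_connect P x y : P \in posets T ->
  rel_of P x y = connect (rel_of (hasse P)) x y.
Proof.
move=> /posetsP[r a t]; apply/idP/idP; last first.
  case/connectP => p + ->; elim: p x => [|z p IH] x /=; first by rewrite r.
  rewrite rel_hasse => /andP[/and3P[_ xz _] /IH]; exact: t.
have [k] := ubnP #|[set z | rel_of P x z && rel_of P z y]|.
elim: k x y => // k IH x y; rewrite ltnS => ck xy.
have [->|nxy] := eqVneq x y; first exact: connect0.
have [c|] := boolP (covers (rel_of P) x y).
  by apply: connect1; rewrite rel_hasse.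
rewrite /covers nxy xy/= => /forallPn[z]; rewrite negb_imply negb_or.
move=> /andP[/andP[xz zy] /andP[zx nzy]].
apply: (@connect_trans _ _ z); apply: IH => //.
  apply: leq_trans ck; apply: proper_card; apply/properP; split.
    by apply/subsetP => w; rewrite !inE => /andP[-> wz]; exact: t wz zy.
  exists y; rewrite !inE ?xy ?r//=; apply/negP => yz.
  by move: nzy; rewrite (a z y) ?eqxx// zy yz.
apply: leq_trans ck; apply: proper_card; apply/properP; split.
  by apply/subsetP => w; rewrite !inE => /andP[zw ->]; rewrite (t _ _ _ xz zw).
exists x; rewrite !inE ?xy ?r ?andbT//=; apply/negP => zx'.
by move: zx; rewrite (a z x) ?eqxx// zx'.
Qed.

Lemma hasse_inj : {in posets T &, injective hasse}.
Proof.
move=> P P' hP hP' h; apply/setP => -[x y].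
by change (rel_of P x y = rel_of P' x y); rewrite !le_connect// h.
Qed.

Definition level A B x : nat := (if x \in A then 0 else if x \in B then 1 else 2)%N.

Lemma level_le2 A B x : (level A B x <= 2)%N.
Proof. by rewrite /level; case: ifP => // _; case: ifP. Qed.

Lemma layered_level E A B x y : layered (rel_of E) A B -> rel_of E x y ->
  level A B y = (level A B x).+1.
Proof.
move=> /andP[dAB /forallP/(_ x)/forallP/(_ y)/implyP h] /h; rewrite /level in_setU negb_or.
have [xA|xA] := boolP (x \in A).
  by rewrite (disjointFr dAB xA)/= orbF => yB; rewrite (disjointFl dAB yB) yB.
by have [xB|xB] := boolP (x \in B) => //= /andP[/negbTE-> /negbTE->].
Qed.

Lemma layered_lt P A B x y : P \in posets T -> layered (rel_of (hasse P)) A B ->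
  rel_of P x y -> x != y -> (level A B x < level A B y)%N.
Proof.
move=> hP lay; rewrite le_connect// => /connectP[p + ->].
have mono z s : path (rel_of (hasse P)) z s -> (level A B z <= level A B (last z s))%N.
  elim: s z => //= w s IH z /andP[/(layered_level lay) zw /IH].
  by rewrite zw; exact: leq_trans.
case: p => [|z p] /=; first by rewrite eqxx.
by move=> /andP[/(layered_level lay) xz /mono]; rewrite xz.
Qed.

(** With three layers directed paths have at most two edges, so this is the full reflexive
    transitive closure. *)
Definition layered_order E : {set T * T} :=
  [set p | [|| p.1 == p.2, rel_of E p.1 p.2 | [exists z, rel_of E p.1 z && rel_of E z p.2]]].

Lemma layered_orderP E A B : layered (rel_of E) A B ->
  layered_order E \in posets T /\ hasse (layered_order E) = E.
Proof.
move=> lay; set le := rel_of (layered_order E).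
have leE x y : le x y = [|| x == y, rel_of E x y | [exists z, rel_of E x z && rel_of E z y]].
  by rewrite /le /rel_of inE.
have lv x y : le x y -> x = y \/ (level A B x < level A B y)%N.
  rewrite leE => /or3P[/eqP|xy|/existsP[z /andP[xz zy]]]; [by left|right|right].
    by rewrite (layered_level lay xy).
  by rewrite (layered_level lay zy) (layered_level lay xz) ltnS leqnSn.
have hP : layered_order E \in posets T.
  apply/posetsP; rewrite -/le; split.
  - by move=> x; rewrite leE eqxx.
  - by move=> x y /andP[/lv[//|xy] /lv[//|yx]]; move: xy yx; lia.
  move=> y x z; rewrite [le x y]leE => /or3P[/eqP->//|xy|/existsP[w /andP[xw wy]]].
    rewrite leE => /or3P[/eqP<-|yz|/existsP[w /andP[yw wz]]].
    - by rewrite leE xy orbT.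
    - by rewrite leE; apply/or3P/Or33/existsP; exists y; rewrite xy.
    have := level_le2 A B z; rewrite (layered_level lay wz) (layered_level lay yw).
    by rewrite (layered_level lay xy).
  move=> /lv[<-|yz].
    by rewrite leE; apply/or3P/Or33/existsP; exists w; rewrite xw.
  have := level_le2 A B z; move: yz; rewrite (layered_level lay wy) (layered_level lay xw).
  by move=> yz z2; have := leq_trans yz z2.
split => //; apply/setP => -[x y]; change (rel_of (hasse (layered_order E)) x y = rel_of E x y).
rewrite rel_hasse /covers -/le; apply/and3P/idP => [[nxy + /forallP h]|xy].
  rewrite leE (negbTE nxy)/= => /orP[//|/existsP[z /andP[xz zy]]].
  have := h z; rewrite -/le !leE xz zy !orbT/= => /orP[/eqP zx|/eqP zy'].
    by have := layered_level lay xz; rewrite zx; lia.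
  by have := layered_level lay zy; rewrite zy'; lia.
have lxy := layered_level lay xy; split.
- by apply/eqP => h; move: lxy; rewrite h; lia.
- by rewrite leE xy orbT.
apply/forallP => z; rewrite -/le; apply/implyP => /andP[/lv[->|xz] /lv[zy|zy]]; rewrite ?eqxx//.
- by rewrite zy eqxx orbT.
- by move: lxy xz zy; lia.
Qed.

Lemma card_layered_le_posets :
  (#|[set E : {set T * T} | [exists A : {set T}, exists B : {set T}, layered (rel_of E) A B]]|
   <= #|posets T|)%N.
Proof.
apply: (leq_trans _ (leq_imset_card hasse (posets T))); apply: subset_leq_card.
apply/subsetP => E; rewrite inE => /existsP[A /existsP[B /layered_orderP[hP hE]]].
by apply/imsetP; exists (layered_order E).
Qed.

End HasseDiagram.

Lemma card_not_nice_posets (R : realType) n (theta : R) r :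
  (#|[set P in posets 'I_n | ~~ `[< exists A B, layered (rel_of (hasse P)) A B /\
      nice (rel_of (hasse P)) theta r A B >]]| <= #|not_nice n theta r|)%N.
Proof.
apply: (leq_card_in_inj (f := @hasse _)).
  by move=> P P' /setIdP[hP _] /setIdP[hP' _]; exact: hasse_inj.
move=> P /setIdP[hP nP]; apply/setIdP; split => //.
by apply/hasse_setP; exact: hasse_diagram_like.
Qed.

(** * Entropy *)

Section Gibbs.
Variable R : realType.

Lemma ln_lt_sub1 (t : R) : 0 < t -> t != 1 -> ln t < t - 1.
Proof.
move=> t0 t1; have := @expR_gt1Dx R (ln t); rewrite ln_eq0// lnK ?posrE// => /(_ t1).
lra.
Qed.

Lemma gibbs_term (p q : R) : 0 <= p -> 0 <= q -> (0 < p -> 0 < q) -> p != q ->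
  p * ln q - p * ln p < q - p.
Proof.
move=> p0 q0 pq npq; have [pE|p1] := eqVneq p 0.
  by rewrite pE in npq *; rewrite !mul0r !subr0 lt_neqAle q0 npq.
have {p0 p1}p0 : 0 < p by rewrite lt_neqAle eq_sym p1.
have {q0 pq}q0 := pq p0.
have h : ln (q / p) < q / p - 1.
  apply: ln_lt_sub1; first by rewrite divr_gt0.
  apply: contra_neq npq => h; have := divfK (lt0r_neq0 p0) q.
  by rewrite h mul1r.
rewrite ln_div ?posrE// in h.
have -> : q - p = p * (q / p - 1) by field; exact: lt0r_neq0.
by rewrite -mulrBr ltr_pM2l.
Qed.

Lemma gibbs_term_le (p q : R) : 0 <= p -> 0 <= q -> (0 < p -> 0 < q) ->
  p * ln q - p * ln p <= q - p.
Proof.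
move=> p0 q0 pq; have [->|npq] := eqVneq p q; first by rewrite !subrr.
by rewrite ltW// gibbs_term.
Qed.

Variables (X : finType) (S : {set X}) (p q : X -> R).
Hypothesis p_ge0 : forall x, x \in S -> 0 <= p x.
Hypothesis q_ge0 : forall x, x \in S -> 0 <= q x.
Hypothesis pq : forall x, x \in S -> 0 < p x -> 0 < q x.
Hypothesis sum_le : \sum_(x in S) q x <= \sum_(x in S) p x.

Lemma gibbs : - \sum_(x in S) p x * ln (p x) <= - \sum_(x in S) p x * ln (q x).
Proof.
rewrite lerN2 -subr_le0 -sumrB (le_trans (_ : _ <= \sum_(x in S) (q x - p x)))//.
  by apply: ler_sum => x xS; apply: gibbs_term_le; [exact: p_ge0|exact: q_ge0|exact: pq].
by rewrite sumrB subr_le0.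
Qed.

Lemma gibbs_lt x0 : x0 \in S -> p x0 != q x0 ->
  - \sum_(x in S) p x * ln (p x) < - \sum_(x in S) p x * ln (q x).
Proof.
move=> x0S npq; rewrite ltrN2 -subr_lt0 -sumrB.
apply: (@lt_le_trans _ _ (\sum_(x in S) (q x - p x))); last by rewrite sumrB subr_le0.
rewrite (bigD1 x0)//= [ltRHS](bigD1 x0)//=; apply: ltr_leD.
  by apply: gibbs_term => //; [exact: p_ge0|exact: q_ge0|exact: pq].
apply: ler_sum => x /andP[xS _]; apply: gibbs_term_le; [exact: p_ge0|exact: q_ge0|exact: pq].
Qed.

End Gibbs.

Lemma entropy_le_card (R : realType) (X : finType) (S : {set X}) (p : X -> R) :
  (forall x, x \in S -> 0 <= p x) -> \sum_(x in S) p x = 1 ->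
  - \sum_(x in S) p x * ln (p x) <= ln #|S|%:R.
Proof.
move=> p0 p1.
have S0 : (0 < #|S|)%N.
  rewrite lt0n; apply/eqP => /eqP; rewrite cards_eq0 => /eqP SE.
  by move: p1; rewrite SE big_set0 => /eqP; rewrite eq_sym oner_eq0.
have S0' : 0 < #|S|%:R :> R by rewrite ltr0n.
apply: le_trans (gibbs (q := fun=> #|S|%:R^-1) p0 _ _ _) _.
- by move=> x _; rewrite invr_ge0.
- by move=> x _ _; rewrite invr_gt0.
- by rewrite sumr_const p1 -[_^-1 *+ _]mulr_natl divff ?gt_eqF.
by rewrite -mulr_suml p1 mul1r lnV ?posrE// opprK.
Qed.

(** * General bounds on [cstar] *)

Section Weightings.
Variables (T : finType) (le : rel T) (R : realType).
Implicit Types (Q A S : {set T}) (a : {set T} -> R).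

Definition antichains Q : {set {set T}} := [set A | antichain le A & A \subset Q].

Lemma shadow_antichains Q S : shadow le Q S \in antichains Q.
Proof.
rewrite inE; apply/andP; split; last by apply/subsetP => y; rewrite inE => /andP[].
apply/forall_inP => x xs; apply/forall_inP => y ys; apply/implyP => xy.
move: xs ys; rewrite !inE => /and3P[xQ ax _] /and3P[yQ _ /exists_inPn/(_ x xQ)].
by rewrite xy ax andbT/= negbK.
Qed.

Lemma wshadow_ge0 Q a A : weighting le a -> 0 <= wshadow le Q a A.
Proof. by move=> [a0 _]; apply: sumr_ge0 => S /andP[/a0]. Qed.

Lemma sum_wshadow Q a : \sum_(A in antichains Q) wshadow le Q a A =
  \sum_(S | antichain le S) a S.
Proof.
rewrite [RHS](partition_big (shadow le Q) (mem (antichains Q)))//=.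
by move=> S _; exact: shadow_antichains.
Qed.

Lemma entropyE Q a : entropy le Q a = - \sum_(A in antichains Q) a A * ln (a A).
Proof. by rewrite /entropy; congr (- _); apply: eq_bigl => A; rewrite inE. Qed.

Lemma cstar_le Q : Q != set0 -> cstar le R <= ln #|antichains Q|%:R / #|Q|%:R.
Proof.
move=> Q0; have [a [wa -> _]] := cstar_max le R.
apply: (@le_trans _ _ (rate le a Q)); first exact: bigmin_le_cond.
rewrite /rate ler_wpM2r ?invr_ge0// entropyE; apply: entropy_le_card.
  by move=> A _; exact: wshadow_ge0.
by rewrite sum_wshadow; case: wa.
Qed.

Lemma cstar_gt a v : weighting le a -> (0 < #|T|)%N ->
  (forall Q, Q != set0 -> v < rate le a Q) -> v < cstar le R.
Proof.
move=> wa T0 h; have [b [wb -> bmax]] := cstar_max le R.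
apply: lt_le_trans (bmax _ wa); apply: lt_bigmin => //; apply: h.
by rewrite -card_gt0 cardsT.
Qed.

End Weightings.

(** * Lower bound on [cstar] for posets with three levels *)

Section ThreeLevels.
Variables (T : finType) (le : rel T) (lv : T -> 'I_3) (R : realType).
Hypothesis le_refl : reflexive le.
Hypothesis le_lv : forall x y, le x y -> x != y -> (lv x < lv y)%N.
Hypothesis T0 : (0 < #|T|)%N.
Implicit Types (Q A S : {set T}) (i j : 'I_3).

Definition layer i := [set x | lv x == i].

Definition layer_weight i S : R := (S \subset layer i)%:R / 2 ^+ #|layer i|.

Definition level_weight S : R := (\sum_i layer_weight i S) / 3.

Lemma layer_antichain i S : S \subset layer i -> antichain le S.
Proof.
move=> /subsetP Si; apply/forall_inP => x /Si xi; apply/forall_inP => y /Si yi.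
apply/implyP => xy; apply/negPn/negP => /(le_lv xy).
by move: xi yi; rewrite !inE => /eqP-> /eqP->; rewrite ltnn.
Qed.

Lemma layer_weight_ge0 i S : 0 <= layer_weight i S.
Proof. by rewrite mulr_ge0// invr_ge0 exprn_ge0. Qed.

Lemma sum_layer_weight i (P : pred {set T}) :
  \sum_(S | antichain le S && P S) layer_weight i S =
  #|[set S : {set T} | (S \subset layer i) && P S]|%:R / 2 ^+ #|layer i|.
Proof.
rewrite -mulr_suml; congr (_ / _); rewrite -natr_sum; congr (_%:R).
rewrite -sum1_card big_mkcond/= [RHS]big_mkcond/=; apply: eq_bigr => S _.
rewrite inE; have [Si|_] := boolP (S \subset layer i); last by case: ifP.
by rewrite (layer_antichain Si).
Qed.

Lemma level_weighting : weighting le level_weight.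
Proof.
split=> [S _|]; first by rewrite divr_ge0// sumr_ge0// => i _; exact: layer_weight_ge0.
rewrite -mulr_suml exchange_big/=.
under eq_bigr => i _.
  under eq_bigl do rewrite -[antichain _ _]andbT.
  rewrite (sum_layer_weight i xpredT).
  have -> : [set S : {set T} | (S \subset layer i) && xpredT S] = powerset (layer i).
    by apply/setP => S; rewrite !inE andbT.
  rewrite card_powerset natrX divff ?expf_neq0 ?pnatr_eq0//.
  over.
by rewrite sumr_const card_ord divff// pnatr_eq0.
Qed.

Section OneSet.
Variable Q : {set T}.
Hypothesis Q0 : Q != set0.

Let beta i A : R := \sum_(S | antichain le S && (shadow le Q S == A)) layer_weight i S.

Let wshadowE A : wshadow le Q level_weight A = (\sum_i beta i A) / 3.
Proof. by rewrite /wshadow -mulr_suml exchange_big. Qed.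

Let beta_ge0 i A : 0 <= beta i A.
Proof. by apply: sumr_ge0 => S _; exact: layer_weight_ge0. Qed.

Let sum_beta i : \sum_(A in antichains le Q) beta i A = 1.
Proof.
rewrite /beta -(partition_big (shadow le Q) (mem (antichains le Q)))/=; last first.
  by move=> S _; exact: shadow_antichains.
under eq_bigl do rewrite -[antichain _ _]andbT.
rewrite (sum_layer_weight i xpredT).
have -> : [set S : {set T} | (S \subset layer i) && xpredT S] = powerset (layer i).
  by apply/setP => S; rewrite !inE andbT.
by rewrite card_powerset natrX divff ?expf_neq0 ?pnatr_eq0.
Qed.

Let shadow_layer i S : S \subset layer i -> shadow le Q S :&: layer i = S :&: Q.
Proof.
move=> /subsetP Si; have {}Si s : s \in S -> lv s = i by move=> /Si; rewrite inE => /eqP.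
apply/setP => x; rewrite !inE; apply/idP/idP.
  move=> /andP[/and3P[xQ /exists_inP[s sS sx] _] /eqP xi]; rewrite xQ andbT.
  have [<-//|nsx] := eqVneq s x.
  by have := le_lv sx nsx; rewrite (Si _ sS) xi ltnn.
move=> /andP[xS xQ]; rewrite xQ (Si _ xS) eqxx andbT/=; apply/andP; split.
  by apply/exists_inP; exists x.
apply/exists_inPn => z zQ; apply/and3P => -[zx nzx /exists_inP[s sS sz]].
have := le_lv zx nzx; have [sz'|nsz] := eqVneq s z.
  by rewrite -sz' (Si _ sS) (Si _ xS) ltnn.
have := le_lv sz nsz; rewrite (Si _ sS) (Si _ xS) => a b.
by have := ltn_trans a b; rewrite ltnn.
Qed.

Let q i := #|Q :&: layer i|.

(** By [shadow_layer] the shadow already fixes [S :&: Q], so [S] is determined by [S :\: Q]. *)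
Let beta_le i A : beta i A <= (2 ^+ q i)^-1.
Proof.
rewrite /beta sum_layer_weight ler_pdivrMr ?exprn_gt0//.
have qi : (q i <= #|layer i|)%N by rewrite subset_leq_card// subsetIr.
rewrite mulrC -expfB_cond ?pnatr_eq0// -natrX ler_nat.
have -> : (2 ^ (#|layer i| - q i))%N = #|powerset (layer i :\: Q)|.
  by rewrite card_powerset cardsD setIC.
apply: (leq_card_in_inj (f := fun S : {set T} => S :\: Q)).
  move=> S S'; rewrite !inE => /andP[Si /eqP SA] /andP[Si' /eqP SA'] h.
  by rewrite -(setID S Q) -(setID S' Q) h -(shadow_layer Si) -(shadow_layer Si') SA SA'.
by move=> S; rewrite !inE => /andP[Si _]; exact: setSD.
Qed.

Let beta_entropy i (b : {set T} -> R) : (forall A, b A <= (2 ^+ q i)^-1) ->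
  (forall A, 0 <= b A) -> \sum_(A in antichains le Q) b A = 1 ->
  (q i)%:R * ln 2 <= - \sum_(A in antichains le Q) b A * ln (b A).
Proof.
move=> bq b0 b1; rewrite -sumrN -[leLHS]mulr1 -[X in _ * X <= _]b1 mulr_sumr; apply: ler_sum => A _.
have [->|nb] := eqVneq (b A) 0; first by rewrite mulr0 mul0r oppr0.
have bA : 0 < b A by rewrite lt_neqAle eq_sym nb b0.
rewrite -mulrN mulrC ler_pM2l//.
have := bq A; rewrite -ler_ln ?posrE ?invr_gt0 ?exprn_gt0// lnV ?posrE ?exprn_gt0//.
by rewrite lnXn// -[ln 2 *+ _]mulr_natl; lra.
Qed.

Let sum_q : #|Q| = (\sum_i q i)%N.
Proof.
rewrite -sum1_card (partition_big lv xpredT)//=; apply: eq_bigr => i _.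
by rewrite /q -sum1_card; apply: eq_bigl => x; rewrite !inE.
Qed.

(** The shadow of [[set x]] contains [x], whereas no set in the layer above has an element below
    [x]. *)
Let beta_neq x : x \in Q -> lv x = 0 :> nat ->
  exists2 A, A \in antichains le Q & beta (inord 0) A != beta (inord 1) A.
Proof.
move=> xQ x0; exists (shadow le Q [set x]); first exact: shadow_antichains.
have xi : x \in layer (inord 0) by rewrite inE; apply/eqP/val_inj; rewrite /= inordK.
have xs : x \in shadow le Q [set x].
  have := @shadow_layer (inord 0) [set x]; rewrite sub1set => /(_ xi)/setP/(_ x).
  by rewrite !inE eqxx xQ; case/andP => /andP[].
rewrite gt_eqF//; have -> : beta (inord 1) (shadow le Q [set x]) = 0.
  apply: big1 => S /andP[_ /eqP SE]; rewrite /layer_weight.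
  have [/subsetP S1|] := boolP (S \subset _); last by rewrite mul0r.
  move: xs; rewrite -SE inE => /and3P[_ /exists_inP[s sS sx] _].
  have : lv s = 1 :> nat by have := S1 _ sS; rewrite inE => /eqP->; rewrite inordK.
  have [->|nsx] := eqVneq s x; first by rewrite x0.
  by have := le_lv sx nsx; rewrite x0.
rewrite /beta (bigD1 [set x])/=; last first.
  by rewrite eqxx andbT; apply: (@layer_antichain (inord 0)); rewrite sub1set.
rewrite ltr_pwDl//; last by apply: sumr_ge0 => S _; exact: layer_weight_ge0.
by rewrite /layer_weight sub1set xi divr_gt0// exprn_gt0.
Qed.

Lemma level_rate : ln 2 / 3 < rate le level_weight Q.
Proof.
pose b := wshadow le Q level_weight.
have bE A : b A = (\sum_i beta i A) / 3 by exact: wshadowE.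
have b0 A : 0 <= b A by apply: wshadow_ge0; exact: level_weighting.
have b1 : \sum_(A in antichains le Q) b A = 1.
  by rewrite sum_wshadow; case: level_weighting.
have ln2 : 0 < ln 2 :> R by rewrite ln_gt0// ltr1n.
(* Cross-entropy against the average [b]. It is linear in [p], so its mean over the three [beta i]
   is the entropy of [b], while Gibbs' inequality bounds each term below by the entropy of
   [beta i]. *)
pose H (p : {set T} -> R) := - \sum_(A in antichains le Q) p A * ln (b A).
have bpos i A : 0 < beta i A -> 0 < b A.
  move=> h; rewrite bE divr_gt0// (bigD1 i)//= ltr_pwDl// sumr_ge0//.
have Hi i : (q i)%:R * ln 2 <= H (beta i).
  apply: le_trans (gibbs _ _ _ _) => //; last by rewrite b1 sum_beta.
  - exact: beta_entropy.
  - by move=> A _; exact: bpos.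
have Hlt i A : A \in antichains le Q -> beta i A != b A -> (q i)%:R * ln 2 < H (beta i).
  move=> AQ nA; apply: le_lt_trans (gibbs_lt (x0 := A) _ _ _ _ _ _) => //; last by rewrite b1 sum_beta.
  - exact: beta_entropy.
  - by move=> B _; exact: bpos.
have HE : 3 * H b = \sum_i H (beta i).
  rewrite /H sumrN mulrN; congr (- _); rewrite exchange_big mulr_sumr; apply: eq_bigr => A _.
  by rewrite -mulr_suml bE mulrA mulrCA divff ?pnatr_eq0// mulr1.
have Qpos : 0 < #|Q|%:R :> R by rewrite ltr0n card_gt0.
rewrite /rate entropyE -/b ltr_pdivlMr// -[X in _ < X]/(H b).
suff : #|Q|%:R * ln 2 < 3 * H b by lra.
have sumqE : #|Q|%:R * ln 2 = \sum_i (q i)%:R * ln 2 :> R by rewrite sum_q natr_sum mulr_suml.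
have [[i [A [AQ nA]]]|same] := pselect (exists i A, A \in antichains le Q /\ beta i A != b A).
  rewrite sumqE HE (bigD1 i)//= [ltRHS](bigD1 i)//=; apply: ltr_leD; first exact: Hlt nA.
  by apply: ler_sum => j _; exact: Hi.
have {}same i A : A \in antichains le Q -> beta i A = b A.
  by move=> AQ; apply/eqP/negPn/negP => nA; apply: same; exists i, A.
have Hb i : (q i)%:R * ln 2 <= H b.
  by rewrite (le_trans (Hi i))// /H lerN2 ler_sum// => A AQ; rewrite same.
have q0 : q (inord 0) = 0%N.
  apply/eqP; rewrite cards_eq0 -subset0; apply/subsetP => x; rewrite !inE => /andP[xQ /eqP x0].
  have [|A AQ] := beta_neq xQ; first by rewrite x0 inordK.
  by rewrite !same// eqxx.
have sum3 : #|Q|%:R = (q (inord 1))%:R + (q (inord 2))%:R :> R.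
  rewrite sum_q !big_ord_recl big_ord0 addn0.
  have e0 : ord0 = inord 0 :> 'I_3 by apply: val_inj; rewrite /= inordK.
  have e1 : lift ord0 ord0 = inord 1 :> 'I_3 by apply: val_inj; rewrite /= inordK.
  have e2 : lift ord0 (lift ord0 ord0) = inord 2 :> 'I_3 by apply: val_inj; rewrite /= inordK.
  by rewrite e2 e1 e0 q0 add0n natrD.
have h1 := Hb (inord 1); have h2 := Hb (inord 2).
have : 0 < #|Q|%:R * ln 2 :> R by rewrite mulr_gt0.
by rewrite sum3 mulrDl; lra.
Qed.

End OneSet.

Lemma cstar_three_levels : ln 2 / 3 < cstar le R.
Proof. exact: (cstar_gt level_weighting T0 level_rate). Qed.

End ThreeLevels.

(** * Posets with three dense layers *)

Lemma card_bounded_sets n r : (#|[set S : {set 'I_n.+1} | #|S| <= r]| <= n.+2 ^ r)%N.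
Proof.
have -> : (n.+2 ^ r = #|[set: r.-tuple (option 'I_n.+1)]|)%N.
  by rewrite cardsT card_tuple card_option card_ord.
apply: (leq_trans _ (leq_imset_card (@elements n r) _)); apply: subset_leq_card.
apply/subsetP => S; rewrite inE => /elements_exists[t <-].
by apply/imsetP; exists t; rewrite ?in_setT.
Qed.

Lemma card_mostly_in n r (X Y Z : {set 'I_n.+1}) :
  (#|[set S : {set 'I_n.+1} | [&& S \subset X :|: (Y :|: Z), #|S :&: Y| <= r & #|S :&: Z| <= r]]|
  <= 2 ^ #|X| * (n.+2 ^ r * n.+2 ^ r))%N.
Proof.
pose B := [set S : {set 'I_n.+1} | (#|S| <= r)%N].
apply: (@leq_trans #|setX (powerset X) (setX B B)|).
  apply: (leq_card_in_inj (f := fun S : {set 'I_n.+1} => (S :&: X, (S :&: Y, S :&: Z)))).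
    move=> S S'; rewrite !inE => /and3P[SX _ _] /and3P[SX' _ _] [hX hY hZ].
    by rewrite -(setIidPl SX) -(setIidPl SX') !setIUr hX hY hZ.
  by move=> S; rewrite inE => /and3P[_ SY SZ]; rewrite !in_setX powersetE subsetIr !inE SY.
by rewrite !cardsX card_powerset leq_mul// leq_mul// card_bounded_sets.
Qed.

Section NicePosets.
Variables (n : nat) (P : {set 'I_n.+1 * 'I_n.+1}) (A B : {set 'I_n.+1}) (r : nat).
Hypothesis hP : P \in posets 'I_n.+1.
Hypothesis dense1 : dense (rel_of (hasse P)) r A B.
Hypothesis dense2 : dense (rel_of (hasse P)) r B (~: (A :|: B)).
Hypothesis rB : (2 * r <= #|B|)%N.
Local Notation e := (rel_of (hasse P)).
Local Notation le := (rel_of P).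

Let e_le x y : e x y -> le x y && (x != y).
Proof. by rewrite rel_hasse => /and3P[-> ->]. Qed.

(** Adjacent layers are excluded by density directly. For the outer two, fewer than [r] vertices of
    [B] receive no edge from [S :&: A] and fewer than [r] send none to the top part of [S]; so some
    vertex of [B] lies between two elements of [S]. *)
Lemma antichain_layers (S : {set 'I_n.+1}) : antichain le S ->
  [/\ ~ ((r <= #|S :&: A|) /\ (r <= #|S :&: B|))%N,
      ~ ((r <= #|S :&: B|) /\ (r <= #|S :&: ~: (A :|: B)|))%N &
      ~ ((r <= #|S :&: A|) /\ (r <= #|S :&: ~: (A :|: B)|))%N].
Proof.
move=> /forall_inP aS.
have inc x y : x \in S -> y \in S -> le x y -> x != y -> False.
  by move=> xS yS xy; have /forall_inP/(_ y yS) := aS x xS; rewrite xy => /eqP->; rewrite eqxx.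
split => -[h1 h2].
- have [x [y [/setIP[xS _] /setIP[yS _] /e_le/andP[]]]] := dense1 (subsetIr _ _) (subsetIr _ _) h1 h2.
  exact: inc.
- have [x [y [/setIP[xS _] /setIP[yS _] /e_le/andP[]]]] := dense2 (subsetIr _ _) (subsetIr _ _) h1 h2.
  exact: inc.
pose U := [set b in B | [exists x in S :&: A, e x b]].
pose V := [set b in B | [exists z in S :&: ~: (A :|: B), e b z]].
have Ur : (#|B :\: U| < r)%N.
  rewrite ltnNge; apply/negP => h.
  have [x [y [xS yU xy]]] := dense1 (subsetIr _ _) (subsetDl _ _) h1 h.
  move: yU; rewrite inE => /andP[+ yB]; rewrite inE yB/= => /negP; apply.
  by apply/exists_inP; exists x.
have Vr : (#|B :\: V| < r)%N.
  rewrite ltnNge; apply/negP => h.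
  have [x [y [xV yS xy]]] := dense2 (subsetDl _ _) (subsetIr _ _) h h2.
  move: xV; rewrite inE => /andP[+ xB]; rewrite inE xB/= => /negP; apply.
  by apply/exists_inP; exists y.
have [b /setIP[]] : exists b, b \in U :&: V.
  apply/set0Pn; apply/negP => /eqP UV; have : B \subset (B :\: U) :|: (B :\: V).
    apply/subsetP => b bB; rewrite !in_setU !in_setD bB !andbT -negb_and.
    by apply/negP => bUV; have : b \in U :&: V by [rewrite in_setI]; rewrite UV inE.
  move/subset_leq_card; rewrite cardsU; move: Ur Vr rB; clear; lia.
rewrite inE => /andP[_ /exists_inP[x /setIP[xS _] xb]].
rewrite inE => /andP[_ /exists_inP[z /setIP[zS _] bz]].
have /posetsP[_ _ tr] := hP.
have /andP[lxb _] := e_le xb; have /andP[lbz _] := e_le bz.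
apply: (inc x z) => //; first exact: tr lxb lbz.
have he := hasse_diagram_like hP.
by apply: contraTneq bz => <-; exact: (hasse_asym he).
Qed.

Lemma nice_antichains m (A' B' C' : {set 'I_n.+1}) :
  A' \subset A -> B' \subset B -> C' \subset ~: (A :|: B) ->
  #|A'| = m -> #|B'| = m -> #|C'| = m ->
  (#|antichains le (A' :|: (B' :|: C'))| <= 3 * (2 ^ m * (n.+2 ^ r * n.+2 ^ r)))%N.
Proof.
move=> sA sB sC cA cB cC.
pose G (X Y Z : {set 'I_n.+1}) :=
  [set S : {set 'I_n.+1} | [&& S \subset X :|: (Y :|: Z), #|S :&: Y| <= r & #|S :&: Z| <= r]%N].
pose F (i : 'I_3) := if i == 0%N :> nat then G A' B' C' else
  if i == 1%N :> nat then G B' A' C' else G C' A' B'.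
have I3 : #|[set: 'I_3]| = 3%N by rewrite cardsT card_ord.
rewrite -(ler_nat rat) natrM -I3.
apply: (card_cover_le (F := F)) => [S|i _]; last first.
  rewrite ler_nat /F; case: ifP => _; first by rewrite -cA; exact: card_mostly_in.
  by case: ifP => _; [rewrite -cB|rewrite -cC]; exact: card_mostly_in.
rewrite inE => /andP[/antichain_layers[hAB hBC hAC] SQ].
have le_of (X X' : {set 'I_n.+1}) : X' \subset X -> (r < #|S :&: X'|)%N -> (r <= #|S :&: X|)%N.
  by move=> XX h; rewrite (leq_trans (ltnW h))// subset_leq_card// setIS.
have [b|b] := leqP #|S :&: B'| r; last first.
  exists (inord 1); rewrite ?in_setT// /F inordK//= inE setUCA SQ/=; apply/andP; split.
    by rewrite leqNgt; apply/negP => a; apply: hAB; split; [exact: le_of sA a|exact: le_of sB b].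
  by rewrite leqNgt; apply/negP => c; apply: hBC; split; [exact: le_of sB b|exact: le_of sC c].
have [c|c] := leqP #|S :&: C'| r; last first.
  exists (inord 2); rewrite ?in_setT// /F inordK//= inE setUC -setUA SQ/= b andbT.
  by rewrite leqNgt; apply/negP => a; apply: hAC; split; [exact: le_of sA a|exact: le_of sC c].
by exists (inord 0); rewrite ?in_setT// /F inordK//= inE SQ b c.
Qed.

End NicePosets.

Lemma subset_of_card (T : finType) (A : {set T}) m : (m <= #|A|)%N ->
  exists A' : {set T}, A' \subset A /\ #|A'| = m.
Proof.
move=> mA; have : (0 < #|[set A' : {set T} | A' \subset A & #|A'| == m]|)%N.
  by rewrite cards_draws bin_gt0.
by rewrite card_gt0 => /set0Pn[A']; rewrite inE => /andP[? /eqP ?]; exists A'.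
Qed.

(** * Upper bound on [cstar] for nice posets *)

Section MainEstimates.
Variable R : realType.

(* With [y ^ 8 = N + 1], the three inequalities compare [y ^ 6] with [y ^ 8]. *)
Lemma size_estimates (theta : R) : 0 < theta <= 1 -> exists n0 : nat, forall n, (n0 <= n)%N ->
  exists r : nat, [/\ 5 * n.+1%:R <= r%:R ^+ 2 :> R, 2 * r%:R <= theta * n.+1%:R &
    (ln 3 + 2 * r%:R * ln n.+2%:R) * ln n.+1%:R <= 3 * (theta * n.+1%:R - 1)].
Proof.
(* The constant comes from [(2 + 64 * y ^ 5) * 8 <= 66 * 8 * y ^ 5]; it is hidden behind a variable
   to keep the arithmetic small. *)
move=> /andP[th0 th1]; have [k kE] : exists k : R, k = 66 * 8 by eexists.
have k1 : 1 <= k by rewrite kE; lra.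
have k10 : 10 <= k by rewrite kE; lra.
pose D := k / theta.
have D0 : 0 < D by rewrite divr_gt0// (lt_le_trans ltr01).
have Dk : k <= D by rewrite ler_pdivlMr// ler_piMr// (le_trans ler01).
exists (Num.truncn (D ^+ 8)) => n nn.
pose L := ln n.+2%:R : R; pose y := expR (L / 8).
have y8 : y ^+ 8 = n.+2%:R by rewrite -expRM_natr divfK ?pnatr_eq0// lnK// posrE ltr0n.
have y0 : 0 < y by exact: expR_gt0.
have Dy : D <= y.
  rewrite -(@ler_pXn2r _ 8) ?nnegrE ?(ltW D0) ?(ltW y0)// y8.
  apply: (le_trans (ltW (truncnS_gt _))); rewrite ler_nat; exact: leqW.
have Ly : L <= 8 * y.
  by have := expR_ge1Dx (L / 8); rewrite -/y => h; lra.
have thy : k <= theta * y.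
  by apply: le_trans (ler_wpM2l (ltW th0) Dy); rewrite mulrC divfK// gt_eqF.
have n1 : n.+1%:R = y ^+ 8 - 1 :> R by rewrite y8 -[n.+2%:R]natr1 addrK.
have y1 : k <= y by apply: le_trans Dy.
have L0 : 0 <= L by rewrite ln_ge0// ler1n.
have L1 : ln n.+1%:R <= L by rewrite ler_ln ?posrE ?ltr0n// ler_nat.
have L10 : 0 <= ln n.+1%:R :> R by rewrite ln_ge0// ler1n.
have ln3 : ln 3 <= 2 :> R.
  have := @expR_ge1Dx R 2; rewrite -(ler_ln _ (expR_gt0 _)) ?posrE// expRK.
  by apply: le_trans; rewrite ler_ln ?posrE//; lra.
have ln30 : 0 <= ln 3 :> R by rewrite ln_ge0// ler1n.
pose r := (Num.truncn (3 * y ^+ 4)).+1.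
have y4 : 1 <= y ^+ 4 by rewrite exprn_ege1//; lra.
have r_lo : 3 * y ^+ 4 < r%:R by exact: truncnS_gt.
have r_hi : r%:R <= 4 * y ^+ 4.
  rewrite /r -(natr1 (Num.truncn _)); have : (Num.truncn (3 * y ^+ 4))%:R <= 3 * y ^+ 4.
    by rewrite truncn_le mulr_ge0// exprn_ge0// ltW.
  by lra.
have y84 : y ^+ 8 = y ^+ 4 * y ^+ 4 by rewrite -exprD.
exists r; split.
- rewrite n1 y84; set z := y ^+ 4 in y4 r_lo *.
  have : 3 * z * (3 * z) <= r%:R * r%:R by rewrite ler_pM ?mulr_ge0 ?(ltW r_lo)//; lra.
  rewrite expr2; have : 0 <= z * z by rewrite mulr_ge0//; lra.
  lra.
- rewrite n1 y84; apply: (@le_trans _ _ (8 * y ^+ 4)); first by move: r_hi; lra.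
  set z := y ^+ 4 in y4 *.
  have yz : y <= z by rewrite /z exprS ler_peMr ?(ltW y0)// exprn_ege1//; lra.
  have h : k * z <= theta * (z * z).
    rewrite mulrA ler_wpM2r//; first lra.
    by apply: le_trans thy _; rewrite ler_wpM2l// ltW.
  have h' : 10 * z <= k * z by rewrite ler_wpM2r//; lra.
  rewrite mulrBr mulr1; lra.
have step : (ln 3 + 2 * r%:R * L) * ln n.+1%:R <= k * y ^+ 6.
  apply: (@le_trans _ _ ((2 + 2 * (4 * y ^+ 4) * (8 * y)) * (8 * y))).
    apply: ler_pM => //.
    - by rewrite addr_ge0// mulr_ge0// mulr_ge0.
    - apply: lerD => //; apply: ler_pM => //.
      by rewrite ler_wpM2l.
    - exact: le_trans Ly.
  have -> : k * y ^+ 6 = k * y ^+ 5 * y by rewrite -mulrA -exprSr.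
  rewrite mulrA ler_wpM2r ?(ltW y0)//.
  have : 1 <= y ^+ 5 by rewrite exprn_ege1//; lra.
  have -> : (2 + 2 * (4 * y ^+ 4) * (8 * y)) * 8 = (2 + 64 * (y ^+ 4 * y)) * 8 by ring.
  rewrite -exprSr kE; lra.
apply: le_trans step _; rewrite n1.
have -> : y ^+ 8 = y ^+ 6 * (y * y) by rewrite -expr2 -exprD.
set z := y ^+ 6; have z1 : 1 <= z by rewrite exprn_ege1//; lra.
have h1 : k <= theta * (y * y).
  by rewrite mulrA; apply: le_trans thy _; rewrite ler_peMr ?mulr_ge0 ?(ltW y0) ?(ltW th0)//; lra.
have h2 : k * z <= theta * (z * (y * y)).
  by rewrite (_ : theta * _ = theta * (y * y) * z); [rewrite ler_wpM2r//; lra|ring].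
have h3 : 10 * z <= k * z by rewrite ler_wpM2r//; lra.
rewrite mulrBr mulr1; lra.
Qed.

Lemma nice_cstar (theta : R) : exists n0 : nat, forall n, (n0 <= n)%N ->
  exists r : nat, 5 * n.+1%:R <= r%:R ^+ 2 :> R /\
  forall (P : {set 'I_n.+1 * 'I_n.+1}) A B, P \in posets 'I_n.+1 ->
    0 < theta <= 1 -> layered (rel_of (hasse P)) A B -> nice (rel_of (hasse P)) theta r A B ->
    0 < cstar (rel_of P) R - ln 2%:R / 3%:R <= 1 / ln n.+1%:R.
Proof.
have [th|nth] := boolP (0 < theta <= 1); last first.
  (* Outside this range of [theta] the claim on posets is vacuous, and [r] only has to satisfy the
     first inequality. *)
  exists 0%N => n _; exists (5 * n.+1)%N; split => [|P A B _ []]//.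
  by rewrite natrM expr2 ler_peMr ?mulr_ge0// -natrM ler1n muln_gt0.
have [n0 hn0] := size_estimates th; have /andP[th0 th1] := th.
exists (maxn n0 1) => n; rewrite geq_max => /andP[nn n1].
have [r [r5 r2 rL]] := hn0 _ nn; exists r; split => // P A B hP _ lay [dA dB dC den1 den2].
have lnn : 0 < ln n.+1%:R :> R by rewrite ln_gt0// ltr1n ltnS.
apply/andP; split.
  rewrite subr_gt0; have /posetsP[rf _ _] := hP.
  apply: (cstar_three_levels (lv := fun x => inord (level A B x))) => //.
    move=> x y xy nxy; rewrite !inordK ?ltnS ?level_le2//.
    exact: (layered_lt hP lay).
  by rewrite card_ord.
have N0 : 0 < n.+1%:R :> R by rewrite ltr0n.
have dens (S : {set 'I_n.+1}) : theta < density R S -> theta * n.+1%:R < #|S|%:R.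
  by rewrite /density card_ord ltr_pdivlMr.
(* Each layer has room for [m] vertices; rounding down is the reason for the [- 1] in
   [size_estimates]. *)
pose m := Num.truncn (theta * n.+1%:R).
have mle : m%:R <= theta * n.+1%:R by rewrite truncn_le mulr_ge0// ltW.
have mge : theta * n.+1%:R - 1 < m%:R.
  by rewrite ltrBlDr natr1; exact: truncnS_gt.
have sub (S : {set 'I_n.+1}) : theta < density R S -> exists S' : {set 'I_n.+1}, S' \subset S /\ #|S'| = m.
  by move=> /dens h; apply: subset_of_card; rewrite -(ler_nat R) (le_trans mle)// ltW.
have [A' [sA cA]] := sub _ dA; have [B' [sB cB]] := sub _ dB; have [C' [sC cC]] := sub _ dC.
have rB : (2 * r <= #|B|)%N.
  by rewrite -(ler_nat R) natrM (le_trans r2)// ltW// dens.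
have m0 : 0 < m%:R :> R.
  apply: le_lt_trans mge; rewrite -(pmulr_rge0 _ (ltr0n R 3)) (le_trans _ rL)//.
  by rewrite mulr_ge0 ?(ltW lnn)// addr_ge0 ?ln_ge0 ?ler1n// mulr_ge0 ?ln_ge0 ?ler1n// mulr_ge0.
pose Q := A' :|: (B' :|: C').
have cQ : #|Q| = (3 * m)%N.
  have /andP[dAB _] := lay.
  have d1 : B' :&: C' = set0.
    apply/eqP; rewrite -subset0; apply: subset_trans (setISS sB sC) _.
    by rewrite setCU setICA setICr setI0.
  have d2 : A' :&: (B' :|: C') = set0.
    apply/eqP; rewrite -subset0; apply: subset_trans (setISS sA (setUSS sB sC)) _.
    by rewrite setIUr (disjoint_setI0 dAB) setCU setIA setICr set0I setU0.
  by rewrite !cardsU d1 d2 cards0 !subn0 cA cB cC !mulSn mul0n addn0.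
have Q0 : Q != set0 by rewrite -card_gt0 cQ muln_gt0/= -(ltr0n R).
rewrite lerBlDr; apply: le_trans (cstar_le (rel_of P) R Q0) _.
have := nice_antichains hP den1 den2 rB sA sB sC cA cB cC; rewrite -/Q cQ => cnt.
have lncnt : ln #|antichains (rel_of P) Q|%:R <= ln 3 + m%:R * ln 2 + 2 * r%:R * ln n.+2%:R :> R.
  have [->|c0] := posnP #|antichains (rel_of P) Q|.
    by rewrite ln0// !addr_ge0 ?ln_ge0 ?ler1n// ?mulr_ge0 ?ln_ge0 ?ler1n// ?mulr_ge0.
  apply: (@le_trans _ _ (ln (3 * (2 ^ m * (n.+2 ^ r * n.+2 ^ r)))%:R)).
    by rewrite ler_ln ?posrE ?ltr0n ?ler_nat// !muln_gt0 !expn_gt0.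
  have p3 : (3 : R) \is Num.pos by rewrite posrE.
  have p2 k : (2 ^+ k : R) \is Num.pos by rewrite posrE exprn_gt0.
  have pn k : (n.+2%:R ^+ k : R) \is Num.pos by rewrite posrE exprn_gt0// ltr0n.
  rewrite natrM natrM natrM !natrX lnM// ?lnM ?rpredM// !lnXn ?ltr0n//.
  by rewrite -[ln 2 *+ m]mulr_natl -[ln _ *+ r]mulr_natl; lra.
have Q3 : 0 < (3 * m)%:R :> R by rewrite natrM mulr_gt0.
rewrite ler_pdivrMr//; apply: le_trans lncnt _.
rewrite natrM [leRHS]mulrDl.
have -> : ln 2 / 3 * (3 * m%:R) = m%:R * ln 2 :> R by field.
have : ln 3 + 2 * r%:R * ln n.+2%:R <= 1 / ln n.+1%:R * (3 * m%:R) :> R.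
  rewrite [leRHS]mulrC.
  rewrite mul1r ler_pdivlMr// (le_trans rL)// ler_wpM2l// ltW//.
lra.
Qed.

End MainEstimates.

(** * Convergence of the proportion *)

Local Open Scope classical_set_scope.
Local Open Scope ring_scope.

Definition near_log2_thirds (R : realType) (K : R) (N : nat) : {set {set 'I_N * 'I_N}} :=
  [set P in posets 'I_N | 0 < cstar (rel_of P) R - ln 2%:R / 3%:R <= K / ln N%:R]%SET.

Lemma few_exceptions (R : realType) : exists n0 : nat, forall n, (n0 <= n)%N ->
  (0 < #|posets 'I_n.+1|)%N /\
  #|(posets 'I_n.+1 :\: near_log2_thirds (1 : R) n.+1)%SET|%:R / #|posets 'I_n.+1|%:R <=
  n.+1%:R^-1 :> R.
Proof.
have [c [theta [n1 [c0 th0 bound]]]] := not_nice_bound R.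
have [n2 hn2] := nice_cstar theta.
have [n3 hn3] := layered_lower R.
have [n4 hn4] := @poly_le_exp2 R c 10 3 c0 (ler0n _ _).
exists (maxn (maxn n1 n2) (maxn n3 n4)) => n.
rewrite !geq_max => /andP[/andP[nn1 nn2] /andP[nn3 nn4]].
have [r [r5 nice_c]] := hn2 _ nn2.
have U0 := kr_main_gt0 R n.+1.
have lower : kr_main R n.+1 <= 2 * n.+2%:R ^+ 2 * #|posets 'I_n.+1|%:R.
  by apply: le_trans (hn3 _ (leqW nn3)) _; rewrite ler_wpM2l ?mulr_ge0 ?exprn_ge0// ler_nat card_layered_le_posets.
have P0 : (0 < #|posets 'I_n.+1|)%N.
  by rewrite lt0n; apply/eqP => h; move: lower; rewrite h mulr0 leNgt U0.
split => //.
have P0' : 0 < #|posets 'I_n.+1|%:R :> R by rewrite ltr0n.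
have sub : (#|posets 'I_n.+1 :\: near_log2_thirds (1 : R) n.+1|%SET <= #|not_nice n.+1 theta r|)%N.
  apply: leq_trans (card_not_nice_posets n.+1 theta r); apply: subset_leq_card.
  apply/subsetP => P /finset.setDP[hP nP]; apply/finset.setIdP; split => //.
  apply/asboolPn => -[A [B [lay nc]]]; case/negP: nP; apply/finset.setIdP; split => //.
  have th1 : 0 < theta <= 1.
    rewrite th0; case: nc => /ltW/le_trans + _ _ _ _; apply.
    by rewrite -(@densityT R 'I_n.+1) ?card_ord// densityS// finset.subsetT.
  exact: nice_c hP th1 lay nc.
have nb := bound n.+1 r (leqW nn1) r5.
(* The factor is [5 * 2] from the two counting bounds; the square in [lower] becomes a cube to leave
   the rate [n.+1%:R^-1]. *)
have e1 : 10 * n.+2%:R ^+ 3 * 2 `^ (- c * n.+1%:R) <= 1 :> R.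
  by rewrite mulNr powRN ler_pdivrMr ?powR_gt0// mul1r; exact: hn4 (leqW nn4).
rewrite ler_pdivrMr// mulrC ler_pdivlMr ?ltr0n//.
apply: (@le_trans _ _ (5 * kr_main R n.+1 * 2 `^ (- c * n.+1%:R) * n.+2%:R)).
  apply: ler_pM => //; last by rewrite ler_nat.
  by apply: le_trans nb; rewrite ler_nat.
apply: (@le_trans _ _ (5 * (2 * n.+2%:R ^+ 2 * #|posets 'I_n.+1|%:R) * 2 `^ (- c * n.+1%:R) * n.+2%:R)).
  by rewrite ler_wpM2r// ler_wpM2r// ler_wpM2l.
rewrite (_ : _ * _ = (10 * n.+2%:R ^+ 3 * 2 `^ (- c * n.+1%:R)) * #|posets 'I_n.+1|%:R); last by ring.
by rewrite -[leRHS]mul1r ler_wpM2r.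
Qed.

Theorem theorem9 (R : realType) :
  exists K : R, 0 < K /\
    (fun N : nat =>
       #|[set P in posets 'I_N |
           0 < cstar (rel_of P) R - ln 2%:R / 3%:R <= K / ln N%:R]%SET|%:R
       / #|posets 'I_N|%:R : R) @ \oo --> (1 : R).
Proof.
exists 1; split => //.
have [n0 hn0] := few_exceptions R.
pose f (N : nat) : R := #|near_log2_thirds (1 : R) N|%:R / #|posets 'I_N|%:R.
suff : f @ \oo --> (1 : R) by [].
(* The estimates concern [n.+1] points, and [harmonic n] is exactly the rate in [few_exceptions]. *)
rewrite -(cvg_shiftS f).
have lim1 : (fun n => 1 - harmonic n : R) @ \oo --> (1 : R).
  rewrite -[X in _ --> X]subr0; apply: cvgB; [exact: cvg_cst|exact: cvg_harmonic].
have lim2 : (fun n : nat => 1 : R) @ \oo --> (1 : R) by exact: cvg_cst.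
apply: (squeeze_cvgr _ lim1 lim2).
exists n0 => // n /= /hn0[P0 h].
have P0' : 0 < #|posets 'I_n.+1|%:R :> R by rewrite ltr0n.
have sub : near_log2_thirds (1 : R) n.+1 \subset posets 'I_n.+1.
  by apply/subsetP => P /finset.setIdP[].
have split : f n.+1 = 1 - #|(posets 'I_n.+1 :\: near_log2_thirds (1 : R) n.+1)%SET|%:R / #|posets 'I_n.+1|%:R.
  rewrite /f -[X in _ = X - _](divff (lt0r_neq0 P0')) -mulrBl; congr (_ / _).
  by rewrite cardsD (finset.setIidPr sub) natrB ?subset_leq_card// opprB addrC subrK.
by rewrite split lerD2l lerN2 h/= lerBlDr lerDl divr_ge0//.
Qed.
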